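(* There exist universal constants $C,K\geqslant 1$ such that the following holds. Let $\mu$ be a measure on a set $D$, let $n\geqslant 1$ be an integer, and let $V_n\subset L^2=L^2(D,\mu)$ be a linear subspace of dimension $n$. Then there exist a random sample $X=\{x^1,\dots,x^m\}\in D^m$ with $m\leqslant Cn$ and a reconstruction map $R:D^m\times\mathbb C^m\to V_n$ (the law of $X$ and the map $R$ depending only on $D,\mu,V_n$ and not on $u$) such that for every $u\in L^2$, $$\mathbb E_X\left(\|u-\tilde u\|^2\right)\leqslant K\, e_n(u)^2,\qquad \text{where } \tilde u:=R\big(x^1,\dots,x^m,u(x^1),\dots,u(x^m)\big).$$
   Context: Functions are complex valued. $L^2=L^2(D,\mu)$ and $\|v\|:=\left(\int_D|v|^2\,d\mu\right)^{1/2}$. The best approximation error is $e_n(u):=\min_{v\in V_n}\|u-v\|$. A random sample is a random element $X=\{x^1,\dots,x^m\}$ of $D^m$ (points may be repeated) drawn according to some probability distribution $\sigma$ on $D^m$; the $x^i$ need not be independent. $\mathbb E_X$ is the expectation over the draw of $X$. Elements of $L^2$ are defined only up to $\mu$-almost everywhere equality; the values $u(x^i)$ are those of an arbitrarily chosen representative of $u$, and part of the assertion is that $\tilde u$ is almost surely independent of this choice. *)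

(* Defs.v *)
From HB Require Import structures.
From mathcomp Require Import all_boot all_order all_algebra.
From mathcomp Require Import complex.
From mathcomp Require Import all_classical all_reals all_analysis.
From mathcomp Require Import measurable_realfun.

Set Implicit Arguments.
Unset Strict Implicit.
Unset Printing Implicit Defensive.
Import Order.TTheory GRing.Theory Num.Theory.

Local Open Scope classical_set_scope.
Local Open Scope ring_scope.
Local Open Scope complex_scope.

Section ComplexL2.
Context d (D : measurableType d) (R : realType).
Variable mu : {measure set D -> \bar R}.
Implicit Types (f g u v : D -> R[i]) (V : set (D -> R[i])).

Definition normL2 f : \bar R := Lnorm mu 2%:E (fun x => (Normc.normc (f x))%:E).

(* MathComp-Analysis has no sigma-algebra on R[i]; Borel measurability of a
   complex function amounts to that of its real and imaginary parts. *)
Definition cmeasurable f : Prop :=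
  measurable_fun [set: D] (fun x => complex.Re (f x)) /\
  measurable_fun [set: D] (fun x => complex.Im (f x)).

(* Elements of L^2(D, mu) are handled through their representatives: two
   members of L2fun denote the same element iff they are equal mu-a.e. *)
Definition L2fun f : Prop := cmeasurable f /\ (normL2 f < +oo)%E.

(* V is the set of all representatives of the members of a linear subspace,
   whence the closure under a.e. equality in the last clause. *)
Definition L2subspace V : Prop :=
  [/\ V `<=` L2fun,
      V (fun=> 0),
      forall f g, V f -> V g -> V (fun x => f x + g x),
      forall (a : R[i]) f, V f -> V (fun x => a * f x)
    & forall f g, V f -> L2fun g -> f = g %[ae mu] -> V g].

(* Freeness and generation hold in L^2, i.e. modulo a.e. equality. *)
Definition L2basis n V (b : 'I_n -> D -> R[i]) : Prop :=
  [/\ forall i, V (b i),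
      forall c : 'I_n -> R[i],
        (fun x => \sum_(i < n) c i * b i x) = (fun=> 0) %[ae mu] ->
        forall i, c i = 0
    & forall f, V f -> exists c : 'I_n -> R[i],
        f = (fun x => \sum_(i < n) c i * b i x) %[ae mu]].

Definition L2dim V n : Prop := exists b : 'I_n -> D -> R[i], L2basis V b.

(* The infimum is a minimum when V is finite-dimensional. *)
Definition best_error V u : \bar R :=
  ereal_inf [set normL2 (fun x => u x - v x) | v in V].

End ComplexL2.

(* Main.v *)
(* Fix an orthonormal basis (a_i) of V_n and let a(x) be the vector of the
   conj(a_i(x)).  Points x^1, ..., x^m (m = 4n) and weights w_j are drawn greedily so that
   almost surely, G = sum_j w_j a(x^j) a(x^j)^* dominates 2n I, while
   E sum_j w_j h(x^j) <= 2m int h dmu for all h >= 0; weighted least squares then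
   gives E |u - ut|^2 <= (1 + 8n / 2n) e_n(u)^2.  The lower bound on G is the barrier
   argument of Batson, Spielman and Srivastava: with P = G - (k - 2n) I after k
   steps, Z = (P - I)^-1, S = tr Z - tr P^-1 and
   L(x) = a(x)^* (S^-1 Z^2 - Z) a(x), adding L(x)^-1 a(x) a(x)^* to P - I
   leaves the trace of the inverse equal to 1/2 as soon as L(x) > 0, and
   int L dmu >= 1 - tr P^-1 = 1/2.  Drawing x with density proportional to the
   positive part of L and taking the weight 1/L(x) thus bounds weight times
   density by 2. *)

Require Import Defs.
From HB Require Import structures.
From mathcomp Require Import all_boot all_order all_algebra.
From mathcomp Require Import ring lra.
From mathcomp Require Import complex.
From mathcomp Require Import all_classical all_reals all_analysis.
From mathcomp Require Import measurable_realfun.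

Set Implicit Arguments.
Unset Strict Implicit.
Unset Printing Implicit Defensive.
Import Order.TTheory GRing.Theory Num.Theory.

Local Open Scope classical_set_scope.
Local Open Scope ring_scope.

(** * Positive definite matrices and the barrier step *)

Section PositiveDefinite.
Local Open Scope sesquilinear_scope.
Variables (C : numClosedFieldType) (n : nat).
Implicit Types (A P : 'M[C]_n) (u v : 'cV[C]_n).

(** Independent draws can need about n log n points before their Gram matrix is well conditioned,
    which is why each draw is adapted to the earlier ones. The points are then dependent and the
    weights random; besides the lower bound on G, only the first-moment bound on sum_j w_j h(x^j) is
    available, but for every h >= 0. It is applied to the squared residual of the orthogonal
    projection and, for independence of the representative, to |u - u'|^2, whose integral is 0. The
    initial shift 2n makes tr P^-1 = n / 2n = 1/2. A trace below 1 forces P > I, and this leaves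
    room to subtract I at each step. Two obstacles shape the construction. The measure [mu] may fail
    to be sigma-finite, so Tonelli is applied to a probability with density proportional to sum_i
    |a_i|^2 instead; every conditional density vanishes where this one does. Moreover the densities
    and weights must be measurable on all tuples, including the null set where the invariant on P
    fails; hence inverses are written with adjugates, and the invariant is asserted almost
    surely. *)

Definition qform A v : C := (v ^t* *m A *m v) 0 0.

Definition posdef A := A ^t* = A /\ forall v, v != 0 -> 0 < qform A v.

Lemma adjmxM m p q (M : 'M[C]_(m, p)) (N : 'M[C]_(p, q)) :
  (M *m N) ^t* = N ^t* *m M ^t*.
Proof. by rewrite trmx_mul map_mxM. Qed.

Lemma adjmxK m p (M : 'M[C]_(m, p)) : M ^t* ^t* = M.
Proof. by apply/matrixP => i j; rewrite !mxE conjCK. Qed.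

Lemma adjmxD m p (M N : 'M[C]_(m, p)) : (M + N) ^t* = M ^t* + N ^t*.
Proof. by rewrite linearD map_mxD. Qed.

Lemma adjmxN m p (M : 'M[C]_(m, p)) : (- M) ^t* = - M ^t*.
Proof. by rewrite linearN map_mxN. Qed.

Lemma adjmxZ m p a (M : 'M[C]_(m, p)) : (a *: M) ^t* = a^* *: M ^t*.
Proof. by rewrite linearZ map_mxZ. Qed.

Lemma adjmx1 : (1%:M : 'M[C]_n) ^t* = 1%:M.
Proof. by rewrite trmx1 map_mx1. Qed.

Lemma qform_scalar a v : qform a%:M v = a * \sum_i `|v i 0| ^+ 2.
Proof.
rewrite /qform mul_mx_scalar -scalemxAl mxE; congr (_ * _).
rewrite mxE; apply: eq_bigr => i _.
by rewrite !mxE mulrC -normCK.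
Qed.

Lemma qformD A P v : qform (A + P) v = qform A v + qform P v.
Proof. by rewrite /qform mulmxDr mulmxDl mxE. Qed.

Lemma qformN A v : qform (- A) v = - qform A v.
Proof. by rewrite /qform mulmxN mulNmx mxE. Qed.

Lemma qformZ a A v : qform (a *: A) v = a * qform A v.
Proof. by rewrite /qform -scalemxAr -scalemxAl mxE. Qed.

Lemma qform_rank1 u v : qform (u *m u ^t*) v = `|(u ^t* *m v) 0 0| ^+ 2.
Proof.
rewrite /qform mulmxA -mulmxA mxE big_ord1 normCK mulrC; congr (_ * _).
by rewrite -[u in LHS]adjmxK -adjmxM !mxE.
Qed.

Lemma qform_mul A (N : 'M[C]_n) v : qform A (N *m v) = qform (N ^t* *m A *m N) v.
Proof. by rewrite /qform adjmxM !mulmxA. Qed.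

Lemma qform0 A : qform A 0 = 0.
Proof. by rewrite /qform mulmx0 mxE. Qed.

Lemma qform_delta A i : qform A (delta_mx i 0) = A i i.
Proof.
rewrite /qform (_ : _ ^t* = delta_mx 0 i).
  by rewrite -rowE -colE !mxE.
by apply/matrixP => j k; rewrite !mxE andbC rmorph_nat.
Qed.

Lemma posdef_ge0 A v : posdef A -> 0 <= qform A v.
Proof.
by move=> [_ pA]; have [->|/pA/ltW//] := eqVneq v 0; rewrite qform0.
Qed.

Lemma posdef_unit A : posdef A -> A \in unitmx.
Proof.
move=> [hA pA]; rewrite unitmxE unitfE; apply/negP => /det0P[v v0 vA].
have := pA (v ^t*); rewrite /qform adjmxK vA mul0mx mxE ltxx.
suff -> : v ^t* != 0 by move=> /(_ isT).
apply: contra_neq v0 => /(congr1 (fun M => M ^t*)); rewrite adjmxK => ->.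
by apply/matrixP => i j; rewrite !mxE conjC0.
Qed.

Lemma adjmx_inv A : A \in unitmx -> (invmx A) ^t* = invmx (A ^t*).
Proof. by move=> uA; rewrite trmx_inv map_invmx. Qed.

Lemma posdef_inv A : posdef A -> posdef (invmx A).
Proof.
move=> pA; have uA := posdef_unit pA; have [hA ppA] := pA.
have hI : (invmx A) ^t* = invmx A by rewrite adjmx_inv // hA.
split=> // v v0; have := ppA (invmx A *m v).
rewrite qform_mul hI mulVmx // mul1mx; apply.
by apply: contra_neq v0 => /(congr1 (mulmx A)); rewrite mulKVmx // mulmx0.
Qed.

Lemma mxtrace_congr A (N : 'M[C]_n) :
  \tr (N ^t* *m A *m N) = \sum_i qform A (col i N).
Proof.
by apply: eq_bigr => i _; rewrite -qform_delta -qform_mul -colE.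
Qed.

Lemma mxtrace_congr_ge0 A (N : 'M[C]_n) : posdef A -> 0 <= \tr (N ^t* *m A *m N).
Proof.
by move=> pA; rewrite mxtrace_congr sumr_ge0// => i _; exact: posdef_ge0.
Qed.

Lemma mxtrace_congr_gt0 A (N : 'M[C]_n) : (0 < n)%N -> posdef A -> N \in unitmx ->
  0 < \tr (N ^t* *m A *m N).
Proof.
move=> n0 pA uN; rewrite mxtrace_congr (bigD1 (Ordinal n0)) //=.
apply: ltr_wpDr; first by apply: sumr_ge0 => i _; exact: posdef_ge0.
apply: pA.2; apply/negP => /eqP /(congr1 (mulmx (invmx N))).
rewrite colE mulmxA mulVmx // mul1mx mulmx0 => /matrixP/(_ (Ordinal n0) 0).
by rewrite !mxE !eqxx => /eqP; rewrite oner_eq0.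
Qed.

Lemma posdef_CauchySchwarz A u v : posdef A ->
  `|(u ^t* *m A *m v) 0 0| ^+ 2 <= qform A u * qform A v.
Proof.
move=> pA; have [hA ppA] := pA.
have [->|u0] := eqVneq u 0.
  by rewrite qform0 mul0r trmx0 map_mx0 !mul0mx mxE normr0 expr0n.
have Au := ppA _ u0.
set c := (u ^t* *m A *m v) 0 0.
have cE : (v ^t* *m A *m u) 0 0 = c^*.
  have -> : v ^t* *m A *m u = (u ^t* *m A *m v) ^t*.
    by rewrite !adjmxM adjmxK hA mulmxA.
  by rewrite mxE mxE.
set p := qform A u in Au *; set q := qform A v.
have p_real : p^* = p by apply/CrealP/ger0_real/ltW.
have E t : qform A (v - t *: u) = q - t * c^* - t^* * c + t^* * t * p.
  rewrite -cE /c /q /p /qform adjmxD adjmxN adjmxZ.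
  rewrite !(mulmxDl, mulmxDr, mulNmx, mulmxN) -!scalemxAr -!scalemxAl -?scalemxAr.
  move: (v ^t* *m A *m v) (u ^t* *m A *m u) (v ^t* *m A *m u) (u ^t* *m A *m v).
  by move=> x1 x2 x3 x4; rewrite !mxE; ring.
(* The coefficient [c / p] minimises the form over all [v - t *: u]; the minimum is
   [q - c * c^* / p]. *)
have := posdef_ge0 (v - (c / p) *: u) pA.
rewrite E rmorphM fmorphV/= p_real normCK.
have p0 : p != 0 by rewrite gt_eqF.
rewrite (_ : _ + _ = (p * q - c * c^*) / p); last by field.
by rewrite pmulr_lge0 ?invr_gt0// subr_ge0.
Qed.

Lemma qform1 v : qform 1%:M v = \sum_i `|v i 0| ^+ 2.
Proof. by rewrite qform_scalar mul1r. Qed.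

(** Coordinate i of [A *m v] pairs the i-th unit vector with v under A, so Cauchy-Schwarz bounds its
    squared modulus by [A i i * qform A v]; summing over i produces the trace. No eigenvalues are
    involved. *)
Lemma qform_sqr_le A v : posdef A -> qform (A *m A) v <= \tr A * qform A v.
Proof.
move=> pA; have [hA _] := pA.
have -> : qform (A *m A) v = qform 1%:M (A *m v) by rewrite qform_mul hA mulmx1.
rewrite qform1 /mxtrace mulr_suml; apply: ler_sum => i _.
have := posdef_CauchySchwarz (delta_mx i 0) v pA.
rewrite qform_delta (_ : (delta_mx i 0) ^t* = delta_mx 0 i).
  by rewrite -mulmxA -rowE mxE.
by apply/matrixP => j k; rewrite !mxE andbC rmorph_nat.
Qed.

(** With y = P v, the squared norm of v is the form of the square of P^-1 at y, at most tr P^-1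
    times the form of P^-1 at y, and the latter is [qform P v]. A trace below 1 thus gives P > I. *)
Lemma posdef_sub1 P : posdef P -> \tr (invmx P) < 1 -> posdef (P - 1%:M).
Proof.
move=> pP tr1; have uP := posdef_unit pP; have pY := posdef_inv pP.
split; first by rewrite adjmxD adjmxN adjmx1 pP.1.
move=> v v0; rewrite qformD qformN subr_gt0.
have vE : v = invmx P *m (P *m v) by rewrite mulKmx.
have y0 : P *m v != 0.
  by apply: contra_neq v0 => /(congr1 (mulmx (invmx P))); rewrite mulKmx // mulmx0.
rewrite vE; move: (P *m v) y0 => y y0; rewrite !qform_mul pY.1 mulmx1 mulVmx // mul1mx.
apply: (le_lt_trans (qform_sqr_le _ pY)).
by rewrite -subr_gt0 -{1}[qform _ _]mul1r -mulrBl mulr_gt0 ?subr_gt0 //; exact: pY.2.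
Qed.

(** By the spectral theorem U diagonalises A with positive eigenvalues, and T is U with its rows
    divided by their square roots. Applied to the Gram matrix of a basis, T is a change to an
    orthonormal one. *)
Lemma posdef_orthonormalize A : posdef A ->
  exists T : 'M[C]_n, T *m A *m T ^t* = 1%:M.
Proof.
move=> pA; have [hA ppA] := pA.
have /orthomx_spectralP : A \is normalmx by apply/normalmxP; rewrite hA.
set U := spectralmx A; set d := spectral_diag A => AE.
have uU : U \is unitarymx by exact: spectral_unitarymx.
have UU : U *m U ^t* = 1%:M by apply/unitarymxP.
rewrite (invmx_unitary uU) in AE.
have UAU : U *m A *m U ^t* = diag_mx d.
  by rewrite AE !mulmxA UU mul1mx -mulmxA UU mulmx1.
have d_gt0 i : 0 < d 0 i.
  have -> : d 0 i = qform A (U ^t* *m delta_mx i 0).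
    by rewrite qform_mul adjmxK UAU qform_delta !mxE eqxx mulr1n.
  apply: ppA; apply/negP => /eqP /(congr1 (mulmx U)).
  rewrite mulmxA UU mul1mx mulmx0 => /matrixP/(_ i 0).
  by rewrite !mxE !eqxx => /eqP; rewrite oner_eq0.
pose s : 'rV[C]_n := \row_i (sqrtC (d 0 i))^-1.
exists (diag_mx s *m U); rewrite adjmxM.
rewrite -[_ *m U *m A]mulmxA -mulmxA [_ *m (U ^t* *m _)]mulmxA UAU.
rewrite tr_diag_mx map_diag_mx !mulmx_diag -diag_const_mx; congr diag_mx.
apply/rowP => i; rewrite !mxE.
have r_gt0 : 0 < sqrtC (d 0 i) by rewrite sqrtC_gt0.
rewrite /=; have -> : ((sqrtC (d 0 i))^-1)^* = (sqrtC (d 0 i))^-1.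
  by apply/CrealP; rewrite realV gtr0_real.
by rewrite -{2}[d 0 i]sqrtCK expr2 mulfK ?mulVf ?gt_eqF.
Qed.

(** * One step of the barrier argument *)

Section BarrierStep.
Variable P : 'M[C]_n.
Hypotheses (n_gt0 : (0 < n)%N) (pdP : posdef P) (trP : \tr (invmx P) < 1).
Let Q := P - 1%:M.
Let Y := invmx P.
Let Z := invmx Q.
Let S := \tr Z - \tr Y.

Let pdQ : posdef Q. Proof. exact: posdef_sub1. Qed.
Let pdY : posdef Y. Proof. exact: posdef_inv. Qed.
Let pdZ : posdef Z. Proof. exact: posdef_inv. Qed.

(** Resolvent identity for a shift by the identity: insert P - Q = I between the two inverses. *)
Let ZY : Z *m Y = Z - Y.
Proof.
have PQ : 1%:M = P - Q by rewrite /Q opprB addrC subrK.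
rewrite -[Z in LHS]mulmx1 PQ mulmxBr mulmxBl -mulmxA mulmxV ?posdef_unit//.
by rewrite mulVmx ?posdef_unit// mulmx1 mul1mx.
Qed.

Let YZ : Y *m Z = Z - Y.
Proof.
have PQ : 1%:M = P - Q by rewrite /Q opprB addrC subrK.
rewrite -[Y in LHS]mulmx1 PQ mulmxBr mulmxBl -[_ *m Q *m _]mulmxA mulmxV ?posdef_unit//.
by rewrite mulVmx ?posdef_unit// mulmx1 mul1mx.
Qed.

(** By the resolvent identities Z - Y = Y Y + Y Z Y, and both terms are congruences of positive
    definite matrices. Positivity of S is what permits dividing by it. *)
Lemma barrier_gap_gt0 : 0 < S.
Proof.
have -> : S = \tr (Y ^t* *m 1%:M *m Y) + \tr (Y ^t* *m Z *m Y).
  by rewrite -linearD/= mulmx1 pdY.1 -mulmxA ZY mulmxBr addrC subrK YZ linearB.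
have pd1 : posdef (1%:M : 'M[C]_n).
  split=> [|v v0]; first exact: adjmx1.
  rewrite qform1 lt_def sumr_ge0 ?andbT => [|i _]; last exact: exprn_ge0.
  apply: contra_neq v0 => /psumr_eq0P v0; apply/matrixP => i j.
  rewrite ord1 mxE; apply/eqP; rewrite -normr_eq0 -sqrf_eq0; apply/eqP.
  by apply: v0 => // k _; exact: exprn_ge0.
by rewrite ltr_wpDl ?mxtrace_congr_ge0 ?mxtrace_congr_gt0 ?posdef_unit.
Qed.

(** Adding w times the rank-one matrix of a to Q lowers tr Z by w q / (1 + w z), where q and z are
    the forms of Z Z and Z at a. Requiring the loss to be S, which cancels the gain from the shift,
    gives 1 / w = q / S - z: the form of this matrix at a. *)
Definition barrier_mx := S^-1 *: (Z *m Z) - Z.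

(* With [t = 1 / S], [0 <= tr ((1 - t Z)^* Y (1 - t Z))] is the Cauchy-Schwarz inequality
   [(tr (Y Z)) ^ 2 <= tr Y * tr (Z Y Z)], where [tr (Y Z) = S]. *)
Lemma barrier_trace : 1 - \tr Y <= \tr barrier_mx.
Proof.
have S0 := barrier_gap_gt0.
have S_real : (S^-1)^* = S^-1 by apply/CrealP; rewrite realV gtr0_real.
have := mxtrace_congr_ge0 (1%:M - S^-1 *: Z) pdY.
rewrite adjmxD adjmxN adjmxZ adjmx1 S_real pdZ.1.
rewrite mulmxBl mul1mx -scalemxAl ZY !mulmxBr !mulmx1 -!scalemxAr mulmxBl YZ.
rewrite -scalemxAl mulmxBl YZ /barrier_mx.
rewrite !(linearB, linearZ)/=.
have -> : \tr Z = S + \tr Y by rewrite subrK.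
set t := \tr (Z *m Z); set y := \tr Y.
move=> h; rewrite -subr_ge0.
have S1 : S != 0 by rewrite gt_eqF.
set h' := (X in 0 <= X) in h.
(* The excess over the claimed bound is [S] times the nonnegative trace [h'] plus [S * (1 - y)]; the
   second term is where [tr Y < 1] enters. *)
have -> : S^-1 * t - (S + y) - (1 - y) = S * h' + S * (1 - y).
  by rewrite /h'; field.
by apply: addr_ge0; apply: mulr_ge0; rewrite ?(ltW S0)// subr_ge0 ltW.
Qed.

(** Makes the values of the form real, so that the weights can be real numbers. *)
Lemma barrier_herm : barrier_mx ^t* = barrier_mx.
Proof.
have S_real : (S^-1)^* = S^-1.
  by apply/CrealP; rewrite realV gtr0_real// barrier_gap_gt0.
by rewrite /barrier_mx adjmxD adjmxN adjmxZ adjmxM pdZ.1 S_real.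
Qed.

(* By the Sherman-Morrison formula the weight is exactly the one that preserves the trace. *)
Lemma barrier_step (a : 'cV[C]_n)
    (P' := P - 1%:M + (qform barrier_mx a)^-1 *: (a *m a ^t*)) :
  0 < qform barrier_mx a -> posdef P' /\ \tr (invmx P') = \tr (invmx P).
Proof.
move=> L0; have S0 := barrier_gap_gt0.
rewrite /P' -/Q -/Y; set L := qform barrier_mx a in L0 *.
have L_real : (L^-1)^* = L^-1 by apply/CrealP; rewrite realV gtr0_real.
have pdP' : posdef (Q + L^-1 *: (a *m a ^t*)).
  split; first by rewrite adjmxD adjmxZ adjmxM adjmxK L_real pdQ.1.
  move=> v v0; rewrite qformD qformZ qform_rank1 ltr_pwDl ?pdQ.2//.
  by rewrite mulr_ge0 ?invr_ge0 ?(ltW L0)// exprn_ge0.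
split=> //.
set q := qform (Z *m Z) a; set z := qform Z a.
have LE : L = S^-1 * q - z by rewrite /L /barrier_mx qformD qformN qformZ.
have z0 : 0 <= z by exact: posdef_ge0.
have q0 : 0 < q.
  have : 0 < S^-1 * q by rewrite -(subrK z (_ * _)) -LE ltr_wpDr.
  by rewrite pmulr_rgt0 // invr_gt0.
have QZ : Q *m Z = 1%:M by rewrite mulmxV ?posdef_unit.
(* With w = 1 / L, the Sherman-Morrison coefficient w / (1 + w z) equals 1 / (L + z), which is
   [S / q] by [LE]. The formula is checked by multiplying out. *)
have -> : invmx (Q + L^-1 *: (a *m a ^t*)) =
    Z - (S / q) *: (Z *m a *m (a ^t* *m Z)).
  apply: (can_inj (mulKmx (posdef_unit pdP'))).
  rewrite mulmxV ?posdef_unit// mulmxBr !(mulmxDl Q) QZ -!scalemxAr -!scalemxAl.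
  rewrite !mulmxA QZ mul1mx.
  have -> : a *m a ^t* *m Z *m a = z *: a.
    rewrite -2!mulmxA (mulmxA (a ^t*)) [X in a *m X]mx11_scalar.
    by rewrite -/(qform Z a) mul_mx_scalar.
  rewrite -!scalemxAl !scalerA -scalerDl -addrA -scalerBl.
  have zE : z = S^-1 * q - L by rewrite LE opprB addrC subrK.
  rewrite [X in X *: _](_ : _ = 0) ?scale0r ?addr0// zE.
  by field; rewrite !gt_eqF.
(* By cyclicity the correction has trace (S / q) q = S, and tr Z - S = tr Y. *)
rewrite linearB linearZ/= mxtrace_mulC.
rewrite (_ : a ^t* *m Z *m (Z *m a) = q%:M); last by rewrite [LHS]mx11_scalar /q /qform !mulmxA.
rewrite mxtrace_scalar mulr1n divfK ?gt_eqF// /S opprB addrC subrK//.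
Qed.

End BarrierStep.

(** * Weighted least squares: exactness and stability *)

Section LeastSquares.
Variables (m : nat) (w : 'I_m -> C) (A : 'I_m -> 'cV[C]_n) (l : C).
Hypotheses (w_ge0 : forall j, 0 <= w j) (l_ge0 : 0 <= l).
Let G := \sum_(j < m) w j *: (A j *m (A j) ^t*).
Hypothesis pdG : posdef (G - l%:M).

Let pG : posdef G.
Proof.
have GE : G = G - l%:M + l%:M by rewrite subrK.
split.
  by rewrite GE adjmxD pdG.1 tr_scalar_mx map_scalar_mx /= (CrealP (ger0_real l_ge0)).
move=> v v0; rewrite GE qformD ltr_wpDr ?pdG.2//.
by rewrite qform_scalar mulr_ge0// sumr_ge0// => i _; rewrite exprn_ge0.
Qed.

Lemma gram_unit : G \in unitmx. Proof. exact: posdef_unit. Qed.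

(** The right-hand side of the normal equations for the data [(A j)^* c] is G c. Exact recovery of
    elements of the space means that the error only sees the residual. *)
Lemma least_squares_exact (c : 'cV[C]_n) :
  invmx G *m (\sum_(j < m) (w j * ((A j) ^t* *m c) 0 0) *: A j) = c.
Proof.
rewrite -[RHS](mulKmx gram_unit); congr (_ *m _).
rewrite mulmx_suml; apply: eq_bigr => j _.
rewrite -scalemxAl -mulmxA [(A j) ^t* *m c in RHS]mx11_scalar mul_mx_scalar.
by rewrite scalerA.
Qed.

(* Expanding [0 <= \sum_j w j * `|r j - (A j)^* z| ^+ 2] and using [G z = \sum_j w j r j A j]. *)
Lemma least_squares_stable (r : 'I_m -> C)
    (z := invmx G *m (\sum_(j < m) (w j * r j) *: A j)) :
  l * \sum_i `|z i 0| ^+ 2 <= \sum_(j < m) w j * `|r j| ^+ 2.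
Proof.
have qG : qform G z = \sum_(j < m) w j * `|((A j) ^t* *m z) 0 0| ^+ 2.
  rewrite /G; elim/big_ind2: _ => [|M x N y <- <-|j _].
  - by rewrite /qform mulmx0 mul0mx mxE.
  - exact: qformD.
  - by rewrite qformZ qform_rank1.
apply: (@le_trans _ _ (qform G z)).
  have := posdef_ge0 z pdG.
  by rewrite qformD qformN qform_scalar subr_ge0.
have Gz : G *m z = \sum_(j < m) (w j * r j) *: A j by rewrite mulKVmx// gram_unit.
have zr : qform G z = \sum_(j < m) w j * (r j * (((A j) ^t* *m z) 0 0)^*).
  rewrite /qform -mulmxA Gz mulmx_sumr summxE; apply: eq_bigr => j _.
  rewrite -scalemxAr mxE mulrA; congr (_ * _).
  have -> : z ^t* *m A j = ((A j) ^t* *m z) ^t* by rewrite adjmxM adjmxK.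
  by rewrite mxE mxE.
have q_real : (qform G z)^* = qform G z by apply/CrealP/ger0_real/posdef_ge0.
have : 0 <= \sum_(j < m) w j * `|r j - ((A j) ^t* *m z) 0 0| ^+ 2.
  by apply: sumr_ge0 => j _; rewrite mulr_ge0// exprn_ge0.
have -> : \sum_(j < m) w j * `|r j - ((A j) ^t* *m z) 0 0| ^+ 2 =
    \sum_(j < m) w j * `|r j| ^+ 2 - qform G z - (qform G z)^* + qform G z.
  rewrite {1 2}zr qG rmorph_sum -!sumrB -big_split/=; apply: eq_bigr => j _.
  have wr : (w j)^* = w j by apply/CrealP/ger0_real.
  by rewrite !rmorphM/= conjCK wr !normCK rmorphB/=; ring.
by rewrite q_real subrK subr_ge0.
Qed.

End LeastSquares.
End PositiveDefinite.

Local Open Scope complex_scope.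

(** * Measures with a density *)

Section Density.
Import HBNNSimple.
Context d (T : measurableType d) (R : realType).
Variables (mu : {measure set T -> \bar R}) (f : T -> R).
Hypotheses (mf : measurable_fun [set: T] f) (f_ge0 : forall x, 0 <= f x).
Local Open Scope ereal_scope.

(* The two proofs are arguments only so that [nu] below determines the measure instance. *)
Definition density_measure of measurable_fun [set: T] f & (forall x, (0 <= f x)%R) :=
  fun A : set T => \int[mu]_(x in A) (f x)%:E.

Local Notation nu := (density_measure mf f_ge0).

Let nu0 : nu set0 = 0.
Proof. exact: integral_set0. Qed.

Let nu_ge0 A : 0 <= nu A.
Proof. by apply: integral_ge0 => x _; rewrite lee_fin. Qed.

Let nu_sigma_additive : semi_sigma_additive nu.
Proof.
move=> F mF tF mUF; rewrite /density_measure; apply: cvg_toP.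
  apply: ereal_nondecreasing_is_cvgn => m n mn.
  apply: lee_sum_nneg_natr => // k _ _.
  by apply: integral_ge0 => x _; rewrite lee_fin.
rewrite ge0_integral_bigcup//=.
- by apply: measurable_funTS; exact: measurableT_comp.
- by move=> x _; rewrite lee_fin.
Qed.

HB.instance Definition _ := isMeasure.Build _ _ _ nu nu0 nu_ge0 nu_sigma_additive.

(** Monotone approximation by simple functions reduces the identity to indicators, for which it is
    the definition of [nu]. This works for an arbitrary [mu]. *)
Lemma integral_density_measure (g : T -> \bar R) :
  measurable_fun [set: T] g -> (forall x, 0 <= g x) ->
  \int[nu]_x g x = \int[mu]_x (g x * (f x)%:E).
Proof.
move=> mg g0; pose h := nnsfun_approx measurableT mg.
have mfE : measurable_fun [set: T] (EFin \o f) by exact: measurableT_comp.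
have -> : \int[nu]_x g x = lim (\int[nu]_x (EFin \o h n) x @[n --> \oo]).
  have gE x : g x = lim ((EFin \o h n) x @[n --> \oo]).
    by apply/esym/cvg_lim => //; exact: cvg_nnsfun_approx.
  under eq_integral do rewrite gE.
  apply: monotone_convergence => //.
  - by move=> n; exact/measurable_EFinP.
  - by move=> n x _ /=; rewrite lee_fin.
  - by move=> x _ a b ab; rewrite lee_fin; exact/lefP/nd_nnsfun_approx.
have -> : \int[mu]_x (g x * (f x)%:E) =
    lim (\int[mu]_x ((EFin \o h n) x * (f x)%:E) @[n --> \oo]).
  have gE x : g x * (f x)%:E = lim (((EFin \o h n) x * (f x)%:E) @[n --> \oo]).
    apply/esym/cvg_lim => //; apply: cvgeZr => //.
    exact: cvg_nnsfun_approx.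
  under eq_integral do rewrite gE.
  apply: monotone_convergence => //.
  - by move=> n; apply/emeasurable_funM => //; exact/measurable_EFinP.
  - by move=> n x _ /=; rewrite mule_ge0 ?lee_fin.
  - move=> x _ a b ab /=; rewrite lee_wpmul2r ?lee_fin//.
    exact/lefP/nd_nnsfun_approx.
congr (lim (_ @ \oo)); apply/funext => n.
transitivity (\int[nu]_x
   (\sum_(y \in range (h n)) (y * \1_(h n @^-1` [set y]) x)%:E)).
  by apply: eq_integral => t _; rewrite /= fimfunE -fsumEFin.
have indich r : measurable_fun [set: T] (fun x => (r * \1_(h n @^-1` [set r]) x)%:E).
  by apply/measurable_EFinP; exact: measurable_funM.
rewrite ge0_integral_fsum//; last by move=> m y Ey; exact: nnfun_muleindic_ge0.
transitivity (\int[mu]_x (\sum_(y \in range (h n))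
    (y * \1_(h n @^-1` [set y]) x)%:E * (f x)%:E)); last first.
  apply: eq_integral => x _; rewrite -ge0_mule_fsuml => [|y].
    by rewrite fsumEFin // -(fimfunE _ x).
  exact: nnfun_muleindic_ge0.
rewrite ge0_integral_fsum//; last 2 first.
  - by move=> y; exact: emeasurable_funM.
  - by move=> m y Ey; apply: mule_ge0; rewrite ?lee_fin//; exact: nnfun_muleindic_ge0.
apply: eq_fsbigr => r rhn.
under [RHS]eq_integral do rewrite EFinM.
under eq_integral do rewrite EFinM.
rewrite integralZl_indic_nnsfun => //.
under [RHS]eq_integral do rewrite -muleA.
(* A negative [r] is not a value of the nonnegative [h n]: its preimage is empty and both sides
   vanish. Otherwise the nonnegative scalar can be pulled out. *)
have [r0|r0] := ltP r 0%R.
  rewrite preimage_nnfun0// !indic0/=.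
  rewrite integral0 mule0 integral0_eq// => x _; rewrite mul0e mule0//.
rewrite ge0_integralZl//.
- congr (_ * _); rewrite integral_indic// setIT /density_measure.
  rewrite [LHS]integral_mkcond; apply: eq_integral => x _.
  by rewrite muleC epatch_indic.
- by apply: emeasurable_funM => //; exact/measurable_EFinP.
- by move=> x _; rewrite mule_ge0 ?lee_fin.
Qed.

End Density.

Lemma density_probability d (T : measurableType d) (R : realType)
    (mu : {measure set T -> \bar R}) (f : T -> R) :
  measurable_fun [set: T] f -> (forall x, 0 <= f x) -> (\int[mu]_x (f x)%:E = 1)%E ->
  exists P : probability T R, forall g : T -> \bar R,
    measurable_fun [set: T] g -> (forall x, (0 <= g x)%E) ->
    (\int[P]_x g x = \int[mu]_x (g x * (f x)%:E))%E.
Proof.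
move=> mf f0 f1.
pose nu := density_measure mu mf f0.
pose bP := @Measure_isProbability.Build _ _ R nu f1.
pose P : probability T R := HB.pack nu bP.
exists P => g mg g0.
exact: (integral_density_measure mu mf f0 mg g0).
Qed.

(** * Complex functions: measurability, integrals and orthogonal projection *)

(** Real-valued and polynomial in the real and imaginary parts, so that measurability and
    inequalities become questions of real arithmetic. *)
Definition sqmod (R : realType) (z : R[i]) : R := complex.Re z ^+ 2 + complex.Im z ^+ 2.

Section Sqmod.
Variable R : realType.
Implicit Types z w : R[i].

Lemma sqmod_ge0 z : 0 <= sqmod z.
Proof. by rewrite addr_ge0 ?sqr_ge0. Qed.

Lemma sqmodE z : (sqmod z)%:C = `|z| ^+ 2.
Proof. exact: add_Re2_Im2. Qed.

Lemma sqmod_normc z : Normc.normc z ^+ 2 = sqmod z.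
Proof. by case: z => a b; rewrite sqr_sqrtr // addr_ge0 ?sqr_ge0. Qed.

Lemma sqmodD_le z w : sqmod (z + w) <= 2 * (sqmod z + sqmod w).
Proof.
case: z w => [a b] [c e]; rewrite /sqmod /=.
by have := sqr_ge0 (a - c); have := sqr_ge0 (b - e); nra.
Qed.

Lemma sqmodM z w : sqmod (z * w) = sqmod z * sqmod w.
Proof. by case: z w => [a b] [c e]; rewrite /sqmod /=; ring. Qed.

Lemma sqmodN z : sqmod (- z) = sqmod z.
Proof. by case: z => [a b]; rewrite /sqmod /=; ring. Qed.

Lemma sqmod0 : sqmod (0 : R[i]) = 0.
Proof. by rewrite /sqmod /= expr0n addr0. Qed.

Lemma sqmod_eq0 z : (sqmod z == 0) = (z == 0).
Proof. by rewrite -(inj_eq (@complexI R)) sqmodE sqrf_eq0 normr_eq0. Qed.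

Lemma mulJ_sqmod z : z * Num.conj z = (sqmod z)%:C.
Proof. by rewrite sqmodE normCK. Qed.

Lemma Re_mulJ_le z w : `|complex.Re (z * Num.conj w)| <= sqmod z + sqmod w.
Proof.
case: z w => [a b] [c e]; rewrite /sqmod /= ler_norml.
have := sqr_ge0 (a - c); have := sqr_ge0 (b - e).
have := sqr_ge0 (a + c); have := sqr_ge0 (b + e).
have := sqr_ge0 a; have := sqr_ge0 b; have := sqr_ge0 c; have := sqr_ge0 e.
by move=> *; apply/andP; split; nra.
Qed.

Lemma Im_mulJ_le z w : `|complex.Im (z * Num.conj w)| <= sqmod z + sqmod w.
Proof.
case: z w => [a b] [c e]; rewrite /sqmod /= ler_norml.
have := sqr_ge0 (a - e); have := sqr_ge0 (b - c).
have := sqr_ge0 (a + e); have := sqr_ge0 (b + c).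
have := sqr_ge0 a; have := sqr_ge0 b; have := sqr_ge0 c; have := sqr_ge0 e.
by move=> *; apply/andP; split; nra.
Qed.

End Sqmod.

Lemma measurable_inv_fun d (T : measurableType d) (R : realType) (f : T -> R) :
  measurable_fun [set: T] f -> measurable_fun [set: T] (fun x => (f x)^-1).
Proof.
move=> mf.
(* Inversion becomes a real power of a nonnegative function; at a zero of [f] both sides are 0,
   because [0^-1 = 0]. *)
have -> : (fun x => (f x)^-1) = (fun x => f x * (f x ^+ 2) `^ (-1)).
  apply/funext => x; rewrite powR_inv1 ?sqr_ge0//.
  have [->|fx0] := eqVneq (f x) 0; first by rewrite invr0 mul0r.
  by rewrite expr2 invfM mulrA mulfV// mul1r.
apply: measurable_funM => //.
by apply: (measurableT_comp (measurable_powR _)); exact: measurable_funX.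
Qed.

(** * Measurability of complex and matrix-valued functions *)

Section ComplexMeasurable.
Context d (T : measurableType d) (R : realType).
Implicit Types f g : T -> R[i].

Lemma cmeasurable_cst (z : R[i]) : cmeasurable (fun _ : T => z).
Proof. by split; exact: measurable_cst. Qed.

Lemma cmeasurableD f g : cmeasurable f -> cmeasurable g ->
  cmeasurable (fun x => f x + g x).
Proof.
move=> [f1 f2] [g1 g2]; split.
  under eq_fun do rewrite raddfD; exact: measurable_funD.
under eq_fun do rewrite raddfD; exact: measurable_funD.
Qed.

Lemma cmeasurableM f g : cmeasurable f -> cmeasurable g ->
  cmeasurable (fun x => f x * g x).
Proof.
have ReM (z w : R[i]) : complex.Re (z * w) =
    complex.Re z * complex.Re w - complex.Im z * complex.Im w.
  by case: z; case: w.
have ImM (z w : R[i]) : complex.Im (z * w) =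
    complex.Re z * complex.Im w + complex.Im z * complex.Re w.
  by case: z; case: w.
move=> [f1 f2] [g1 g2]; split.
  under eq_fun do rewrite ReM; apply: measurable_funB; exact: measurable_funM.
under eq_fun do rewrite ImM; apply: measurable_funD; exact: measurable_funM.
Qed.

Lemma cmeasurable_realC (f : T -> R) : measurable_fun [set: T] f ->
  cmeasurable (fun x => (f x)%:C).
Proof. by move=> mf; split => //=; exact: measurable_cst. Qed.

Lemma cmeasurable_conj f : cmeasurable f -> cmeasurable (fun x => Num.conj (f x)).
Proof.
move=> [f1 f2]; split.
  by rewrite (_ : (fun _ => _) = (fun x => complex.Re (f x)))//;
    apply/funext => x; case: (f x).
rewrite (_ : (fun _ => _) = (fun x => - complex.Im (f x))).
  exact: measurable_funN.
by apply/funext => x; case: (f x).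
Qed.

Lemma measurable_sqmod f : cmeasurable f -> measurable_fun [set: T] (fun x => sqmod (f x)).
Proof. by move=> [f1 f2]; apply: measurable_funD; exact: measurable_funX. Qed.

Lemma cmeasurable_inv f : cmeasurable f -> cmeasurable (fun x => (f x)^-1).
Proof.
move=> mf; rewrite (_ : (fun _ => _) = fun x => ((sqmod (f x))^-1)%:C * Num.conj (f x)).
  apply: cmeasurableM; last exact: cmeasurable_conj.
  by apply: cmeasurable_realC; apply: measurable_inv_fun; exact: measurable_sqmod.
apply/funext => x; have -> : ((sqmod (f x))^-1)%:C = (`|f x| ^+ 2)^-1.
  by rewrite -sqmodE; exact: (fmorphV (real_complex R)).
rewrite normCK.
have [->|f0] := eqVneq (f x) 0; first by rewrite invr0 rmorph0 mulr0.
by rewrite invfM -mulrA mulVf ?mulr1// conjC_eq0.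
Qed.

Lemma cmeasurable_sum (I : Type) (s : seq I) (P : pred I) (f : I -> T -> R[i]) :
  (forall i, cmeasurable (f i)) -> cmeasurable (fun x => \sum_(i <- s | P i) f i x).
Proof.
move=> mf; elim: s => [|i s IH].
  under eq_fun do rewrite big_nil; exact: cmeasurable_cst.
under eq_fun do rewrite big_cons; case: (P i) => //; exact: cmeasurableD.
Qed.

Lemma cmeasurable_prod (I : Type) (s : seq I) (P : pred I) (f : I -> T -> R[i]) :
  (forall i, cmeasurable (f i)) -> cmeasurable (fun x => \prod_(i <- s | P i) f i x).
Proof.
move=> mf; elim: s => [|i s IH].
  under eq_fun do rewrite big_nil; exact: cmeasurable_cst.
under eq_fun do rewrite big_cons; case: (P i) => //; exact: cmeasurableM.
Qed.

Definition mx_measurable m n (F : T -> 'M[R[i]]_(m, n)) :=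
  forall i j, cmeasurable (fun x => F x i j).

Lemma mx_measurable_cst m n (A : 'M[R[i]]_(m, n)) : mx_measurable (fun _ => A).
Proof. by move=> i j; exact: cmeasurable_cst. Qed.

Lemma mx_measurableD m n (F G : T -> 'M[R[i]]_(m, n)) :
  mx_measurable F -> mx_measurable G -> mx_measurable (fun x => F x + G x).
Proof. by move=> mF mG i j; under eq_fun do rewrite mxE; exact: cmeasurableD. Qed.

Lemma mx_measurableZ m n (f : T -> R[i]) (F : T -> 'M[R[i]]_(m, n)) :
  cmeasurable f -> mx_measurable F -> mx_measurable (fun x => f x *: F x).
Proof. by move=> mf mF i j; under eq_fun do rewrite mxE; exact: cmeasurableM. Qed.

Lemma mx_measurableN m n (F : T -> 'M[R[i]]_(m, n)) :
  mx_measurable F -> mx_measurable (fun x => - F x).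
Proof.
move=> mF; under eq_fun do rewrite -scaleN1r.
by apply: mx_measurableZ => //; exact: cmeasurable_cst.
Qed.

Lemma mx_measurableM m n p (F : T -> 'M[R[i]]_(m, n)) (G : T -> 'M[R[i]]_(n, p)) :
  mx_measurable F -> mx_measurable G -> mx_measurable (fun x => F x *m G x).
Proof.
move=> mF mG i j; under eq_fun do rewrite mxE.
by apply: cmeasurable_sum => k; exact: cmeasurableM.
Qed.

Lemma mx_measurable_adj m n (F : T -> 'M[R[i]]_(m, n)) :
  mx_measurable F -> mx_measurable (fun x => map_mx Num.conj (F x)^T).
Proof.
by move=> mF i j; under eq_fun do rewrite !mxE; exact: cmeasurable_conj.
Qed.

Lemma mx_measurable_sum (I : Type) (s : seq I) (P : pred I) m n
    (F : I -> T -> 'M[R[i]]_(m, n)) :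
  (forall i, mx_measurable (F i)) -> mx_measurable (fun x => \sum_(i <- s | P i) F i x).
Proof.
move=> mF i j; under eq_fun do rewrite summxE.
by apply: cmeasurable_sum => k; exact: mF.
Qed.

Lemma cmeasurable_mxtrace n (F : T -> 'M[R[i]]_n) :
  mx_measurable F -> cmeasurable (fun x => \tr (F x)).
Proof. by move=> mF; exact: cmeasurable_sum. Qed.

Lemma cmeasurable_det n (F : T -> 'M[R[i]]_n) :
  mx_measurable F -> cmeasurable (fun x => \det (F x)).
Proof.
move=> mF; apply: cmeasurable_sum => s; apply: cmeasurableM.
  exact: cmeasurable_cst.
by apply: cmeasurable_prod => i; exact: mF.
Qed.

(** The determinant and the cofactors are polynomials in the entries, and the convention [0^-1 = 0]
    keeps the quotient measurable across singular matrices. *)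
Lemma mx_measurable_inv n (F : T -> 'M[R[i]]_n) :
  mx_measurable F -> mx_measurable (fun x => (\det (F x))^-1 *: \adj (F x)).
Proof.
move=> mF; apply: mx_measurableZ.
  by apply: cmeasurable_inv; exact: cmeasurable_det.
move=> i j; under eq_fun do rewrite mxE /cofactor.
apply: cmeasurableM; first exact: cmeasurable_cst.
by apply: cmeasurable_det => k l; under eq_fun do rewrite !mxE; exact: mF.
Qed.

End ComplexMeasurable.

Lemma cmeasurable_comp d d' (T : measurableType d) (U : measurableType d')
    (R : realType) (f : U -> R[i]) (g : T -> U) :
  cmeasurable f -> measurable_fun [set: T] g -> cmeasurable (fun x => f (g x)).
Proof.
move=> [f1 f2] mg; split; first exact: (measurableT_comp f1 mg).
exact: (measurableT_comp f2 mg).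
Qed.

Lemma mx_measurable_comp d d' (T : measurableType d) (U : measurableType d')
    (R : realType) m n (F : U -> 'M[R[i]]_(m, n)) (g : T -> U) :
  mx_measurable F -> measurable_fun [set: T] g -> mx_measurable (fun x => F (g x)).
Proof. by move=> mF mg i j; exact: (cmeasurable_comp (mF i j) mg). Qed.

(** * Complex integrals and square-integrable functions *)

Section ComplexIntegral.
Context d (T : measurableType d) (R : realType).
Variable mu : {measure set T -> \bar R}.
Implicit Types f g : T -> R[i].

Definition cintegrable f :=
  mu.-integrable [set: T] (EFin \o (fun x => complex.Re (f x))) /\
  mu.-integrable [set: T] (EFin \o (fun x => complex.Im (f x))).

Definition cint f : R[i] :=
  (\int[mu]_x complex.Re (f x)) +i* (\int[mu]_x complex.Im (f x)).

Lemma cintegrableD f g : cintegrable f -> cintegrable g ->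
  cintegrable (fun x => f x + g x).
Proof.
move=> [f1 f2] [g1 g2]; split.
  by apply: eq_integrable (integrableD _ f1 g1) => // x _ /=; rewrite raddfD.
by apply: eq_integrable (integrableD _ f2 g2) => // x _ /=; rewrite raddfD.
Qed.

Lemma cintD f g : cintegrable f -> cintegrable g ->
  cint (fun x => f x + g x) = cint f + cint g.
Proof.
move=> [f1 f2] [g1 g2]; rewrite /cint.
under eq_Rintegral do rewrite raddfD/=.
under [X in _ +i* X]eq_Rintegral do rewrite raddfD/=.
by rewrite !RintegralD.
Qed.

Lemma cintegrableZ a f : cintegrable f -> cintegrable (fun x => a * f x).
Proof.
move=> [f1 f2]; split; case: a => a b.
  apply: eq_integrable (integrableB _ (integrableZl _ a f1) (integrableZl _ b f2)) => //.
  by move=> x _ /=; case: (f x).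
apply: eq_integrable (integrableD _ (integrableZl _ a f2) (integrableZl _ b f1)) => //.
by move=> x _ /=; case: (f x).
Qed.

Lemma cintZ a f : cintegrable f -> cint (fun x => a * f x) = a * cint f.
Proof.
move=> [f1 f2]; rewrite /cint; case: a => a b.
have E1 x : complex.Re ((a +i* b) * f x) = a * complex.Re (f x) - b * complex.Im (f x).
  by case: (f x).
have E2 x : complex.Im ((a +i* b) * f x) = a * complex.Im (f x) + b * complex.Re (f x).
  by case: (f x).
under eq_Rintegral do rewrite E1.
under [X in _ +i* X]eq_Rintegral do rewrite E2.
have Z (c : R) (h : T -> R) : mu.-integrable [set: T] (EFin \o h) ->
    mu.-integrable [set: T] (EFin \o (fun x => c * h x)).
  by move=> ih; apply: eq_integrable (integrableZl _ c ih).
by rewrite RintegralB ?RintegralD ?RintegralZl//; exact: Z.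
Qed.

Lemma cint0 : cint (fun=> 0) = 0.
Proof. by rewrite /cint /= !Rintegral_cst// !mul0r. Qed.

Lemma cintegrable0 : cintegrable (fun=> 0).
Proof. by split; exact: integrable0. Qed.

Lemma cintegrable_sum (I : Type) (s : seq I) (f : I -> T -> R[i]) :
  (forall i, cintegrable (f i)) -> cintegrable (fun x => \sum_(i <- s) f i x).
Proof.
move=> fi; elim: s => [|i s IH].
  by under eq_fun do rewrite big_nil; exact: cintegrable0.
by under eq_fun do rewrite big_cons; exact: cintegrableD.
Qed.

Lemma cint_sum (I : Type) (s : seq I) (f : I -> T -> R[i]) :
  (forall i, cintegrable (f i)) ->
  cint (fun x => \sum_(i <- s) f i x) = \sum_(i <- s) cint (f i).
Proof.
move=> fi; elim: s => [|i s IH].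
  by under eq_fun do rewrite big_nil; rewrite cint0 big_nil.
under eq_fun do rewrite big_cons.
by rewrite cintD ?IH ?big_cons//; exact: cintegrable_sum.
Qed.

Lemma cint_conj f : cintegrable f -> cint (fun x => Num.conj (f x)) = Num.conj (cint f).
Proof.
move=> [f1 f2]; rewrite /cint /=; congr (_ +i* _).
  by apply: eq_Rintegral => x _; case: (f x).
rewrite -mulN1r -RintegralZl//.
by apply: eq_Rintegral => x _; rewrite mulN1r; case: (f x).
Qed.

Lemma normL2_sqr f : (normL2 mu f ^+ 2 = \int[mu]_x (sqmod (f x))%:E)%E.
Proof.
rewrite /normL2.
have N0 := Lnorm_ge0 mu 2%:E (fun x => (Normc.normc (f x))%:E).
have := poweR_Lnorm mu (fun x => (Normc.normc (f x))%:E) (r := 2) (lt0r_neq0 (ltr0Sn _ 1)).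
rewrite (eq_integral (fun x => (sqmod (f x))%:E)) => [<-|x _]; last first.
  by rewrite abse_EFin poweR_EFin powR_mulrn// -sqmod_normc real_normK ?num_real.
case: (Lnorm _ _ _) N0 => [r r0| _|//]; last by rewrite poweRyr.
by rewrite poweR_EFin powR_mulrn// EFin_expe.
Qed.

(** Exhibits the norm as a measurable function of an integral, the form in which the error is shown
    to be measurable in the sample. *)
Lemma normL2E f : (normL2 mu f = (\int[mu]_x (sqmod (f x))%:E) `^ 2^-1)%E.
Proof.
rewrite /normL2 unlock; congr poweR; apply: eq_integral => x _.
by rewrite abse_EFin poweR_EFin powR_mulrn// -sqmod_normc real_normK ?num_real.
Qed.

Lemma normL2_ge0 f : (0 <= normL2 mu f)%E.
Proof. exact: Lnorm_ge0. Qed.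

Lemma L2funP f : L2fun mu f <-> cmeasurable f /\ (\int[mu]_x (sqmod (f x))%:E < +oo)%E.
Proof.
rewrite /L2fun -normL2_sqr; split=> -[mf h]; split=> //;
  move: (normL2_ge0 f) h; case: (normL2 mu f) => //= r _ _; exact: ltry.
Qed.

Lemma L2fun_integrable f : L2fun mu f ->
  mu.-integrable [set: T] (EFin \o (fun x => sqmod (f x))).
Proof.
move=> /L2funP[mf foo]; apply/integrableP; split.
  by apply/measurable_EFinP; exact: measurable_sqmod.
by under eq_integral do rewrite /= ger0_norm ?sqmod_ge0//.
Qed.

(** Real and imaginary parts of the product are dominated by the integrable [sqmod f + sqmod g]. *)
Lemma cintegrable_mulJ f g : L2fun mu f -> L2fun mu g ->
  cintegrable (fun x => f x * Num.conj (g x)).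
Proof.
move=> Lf Lg; have [[mf _] [mg _]] := (Lf, Lg).
have [m1 m2] := cmeasurableM mf (cmeasurable_conj mg).
have ifg := integrableD measurableT (L2fun_integrable Lf) (L2fun_integrable Lg).
split; apply: le_integrable ifg => //; try exact/measurable_EFinP.
  move=> x _ /=; rewrite lee_fin [leRHS]ger0_norm ?Re_mulJ_le//.
  by rewrite addr_ge0 ?sqmod_ge0.
move=> x _ /=; rewrite lee_fin [leRHS]ger0_norm ?Im_mulJ_le//.
by rewrite addr_ge0 ?sqmod_ge0.
Qed.

Lemma L2funD f g : L2fun mu f -> L2fun mu g -> L2fun mu (fun x => f x + g x).
Proof.
move=> Lf Lg; have [[mf _] [mg _]] := (Lf, Lg).
have mfg := cmeasurableD mf mg.
apply/L2funP; split => //.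
have /integrableP[_] : mu.-integrable [set: T] (EFin \o (fun x => sqmod (f x + g x))).
  apply: le_integrable (integrableZl measurableT 2
    (integrableD measurableT (L2fun_integrable Lf) (L2fun_integrable Lg))) => //.
    by apply/measurable_EFinP; exact: measurable_sqmod.
  move=> x _ /=; rewrite lee_fin !ger0_norm ?sqmod_ge0 ?sqmodD_le//.
  by rewrite mulr_ge0// addr_ge0 ?sqmod_ge0.
by under eq_integral do rewrite /= ger0_norm ?sqmod_ge0//.
Qed.

Lemma L2funZ a f : L2fun mu f -> L2fun mu (fun x => a * f x).
Proof.
move=> Lf; have [mf _] := Lf; apply/L2funP; split.
  by apply: cmeasurableM => //; exact: cmeasurable_cst.
have /integrableP[_] := integrableZl measurableT (sqmod a) (L2fun_integrable Lf).
by under eq_integral do rewrite /= ger0_norm ?mulr_ge0 ?sqmod_ge0// -sqmodM.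
Qed.

Lemma L2fun0 : L2fun mu (fun=> 0).
Proof.
apply/L2funP; split; first exact: cmeasurable_cst.
by under eq_integral do rewrite sqmod0; rewrite integral0.
Qed.

Lemma L2fun_sum n (c : 'I_n -> R[i]) (a : 'I_n -> T -> R[i]) :
  (forall i, L2fun mu (a i)) -> L2fun mu (fun x => \sum_(i < n) c i * a i x).
Proof.
move=> La; elim: (index_enum _) => [|i s IH].
  by under eq_fun do rewrite big_nil; exact: L2fun0.
by under eq_fun do rewrite big_cons; apply: L2funD => //; exact: L2funZ.
Qed.

Lemma integral_sqmod f : L2fun mu f ->
  cint (fun x => f x * Num.conj (f x)) = (fine (\int[mu]_x (sqmod (f x))%:E)%E)%:C.
Proof.
move=> Lf; under eq_fun do rewrite mulJ_sqmod.
by rewrite /cint /= Rintegral_cst// mul0r.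
Qed.

Lemma integral_sqmod_fin f : L2fun mu f ->
  (\int[mu]_x (sqmod (f x))%:E)%E = (complex.Re (cint (fun x => f x * Num.conj (f x))))%:E.
Proof.
move=> Lf; rewrite integral_sqmod//= fineK//.
exact: integrable_fin_num (L2fun_integrable Lf).
Qed.

End ComplexIntegral.

Section LinearCombination.
Context (T : Type) (R : realType) (n : nat).
Implicit Types (c e : 'I_n -> R[i]) (a : 'I_n -> T -> R[i]).

Definition lincomb c a x : R[i] := \sum_(i < n) c i * a i x.

Lemma lincombB c e a x : lincomb c a x - lincomb e a x = lincomb (fun i => c i - e i) a x.
Proof. by rewrite /lincomb -sumrB; apply: eq_bigr => i _; rewrite mulrBl. Qed.

End LinearCombination.

(** * Orthonormal bases and orthogonal projection *)

Section Orthonormal.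
Context d (T : measurableType d) (R : realType).
Variable mu : {measure set T -> \bar R}.
Variable n : nat.
Implicit Types (c e : 'I_n -> R[i]) (a : 'I_n -> T -> R[i]).

Definition L2orthonormal a :=
  forall i j, cint mu (fun x => a i x * Num.conj (a j x)) = (i == j)%:R.

Lemma cint_lincomb c e a : (forall i, L2fun mu (a i)) ->
  cint mu (fun x => lincomb c a x * Num.conj (lincomb e a x)) =
  \sum_(i < n) \sum_(j < n)
     c i * Num.conj (e j) * cint mu (fun x => a i x * Num.conj (a j x)).
Proof.
move=> La.
have Ia i j : cintegrable mu
    (fun x => c i * Num.conj (e j) * (a i x * Num.conj (a j x))).
  exact/cintegrableZ/cintegrable_mulJ.
under eq_fun.
  move=> x; rewrite /lincomb mulr_suml.
  under eq_bigr.
    move=> i _; rewrite rmorph_sum mulr_sumr.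
    under eq_bigr do rewrite rmorphM mulrACA/=.
    over.
  over.
rewrite cint_sum; last by move=> i; exact: cintegrable_sum.
apply: eq_bigr => i _; rewrite cint_sum//; apply: eq_bigr => j _.
by rewrite cintZ//; exact: cintegrable_mulJ.
Qed.

Lemma integral_sqmod_eq0 (f : T -> R[i]) : cmeasurable f ->
  (\int[mu]_x (sqmod (f x))%:E)%E = 0%E -> f = (fun=> 0) %[ae mu].
Proof.
move=> mf f0.
have mE : measurable_fun [set: T] (fun x => (sqmod (f x))%:E).
  by apply/measurable_EFinP; exact: measurable_sqmod.
have : (\int[mu]_x `|(sqmod (f x))%:E|)%E = 0%E.
  by under eq_integral do rewrite gee0_abs ?lee_fin ?sqmod_ge0//.
move/(ae_eq_integral_abs mu measurableT mE).
apply: filterS => x /(_ I) /= h _; move: h => [] /eqP.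
by rewrite sqmod_eq0 => /eqP.
Qed.

Lemma ae_eq_integral_sqmod (f g : T -> R[i]) : cmeasurable f -> cmeasurable g ->
  f = g %[ae mu] ->
  (\int[mu]_x (sqmod (f x))%:E = \int[mu]_x (sqmod (g x))%:E)%E.
Proof.
move=> mf mg fg; apply: ge0_ae_eq_integral => //.
- by apply/measurable_EFinP; exact: measurable_sqmod.
- by apply/measurable_EFinP; exact: measurable_sqmod.
- by move=> x _; rewrite lee_fin sqmod_ge0.
- by move=> x _; rewrite lee_fin sqmod_ge0.
by apply: filterS fg => x /= h xT; rewrite h.
Qed.

Lemma L2subspace_lincomb V c a : L2subspace mu V -> (forall i, V (a i)) -> V (lincomb c a).
Proof.
move=> [_ V0 VD VZ _] Va; rewrite /lincomb.
elim: (index_enum _) => [|i s IH].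
  by under eq_fun do rewrite big_nil; exact: V0.
by under eq_fun do rewrite big_cons; apply: VD => //; exact: VZ.
Qed.

(** The Gram matrix H of a basis is positive definite, since its form is the squared norm of a
    combination and the basis is free modulo a.e. equality. If S brings H to the identity, the rows
    of S are the coefficients of an orthonormal family, and S is invertible, so the span is kept. *)
Lemma orthonormal_basis V : L2subspace mu V -> L2dim mu V n ->
  exists a : 'I_n -> T -> R[i], [/\ forall i, V (a i), L2orthonormal a
    & forall f, V f -> exists c, f = lincomb c a %[ae mu]].
Proof.
move=> sV [b [Vb free span]]; have [VL2 _ _ _ _] := sV.
have Lb i : L2fun mu (b i) by exact: VL2.
pose H : 'M[R[i]]_n := \matrix_(i, j) cint mu (fun x => b i x * Num.conj (b j x)).
have qH (v : 'cV_n) : qform H v =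
    cint mu (fun x => lincomb (fun i => Num.conj (v i 0)) b x *
                      Num.conj (lincomb (fun i => Num.conj (v i 0)) b x)).
  rewrite cint_lincomb// exchange_big/= /qform mxE; apply: eq_bigr => j _.
  rewrite mxE mulr_suml; apply: eq_bigr => i _.
  by rewrite !mxE conjCK mulrAC.
have pdH : posdef H.
  split.
    apply/matrixP => i j; rewrite !mxE -cint_conj; last exact: cintegrable_mulJ.
    by congr cint; apply/funext => x; rewrite rmorphM/= conjCK mulrC.
  move=> v v0; rewrite qH integral_sqmod; last exact: L2fun_sum.
  rewrite (_ : 0 = 0%:C)// ltcR lt_def fine_ge0 ?andbT; last first.
    by apply: integral_ge0 => x _; rewrite lee_fin sqmod_ge0.
  set f := lincomb _ _.
  have Lf : L2fun mu f by exact: L2fun_sum.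
  apply: contra_neq v0 => f0.
  have /(integral_sqmod_eq0 Lf.1)/free h : (\int[mu]_x (sqmod (f x))%:E)%E = 0%E.
    by rewrite -[LHS]fineK ?f0//; exact: integrable_fin_num (L2fun_integrable Lf).
  apply/matrixP => i j; rewrite ord1 mxE -[LHS]conjCK.
  by rewrite h conjC0.
have [S SHS] := posdef_orthonormalize pdH.
have uS : S \in unitmx by have [] := mulmx1_unit (etrans (mulmxA _ _ _) SHS).
exists (fun i => lincomb (fun k => S i k) b); split.
- by move=> i; exact: L2subspace_lincomb.
- move=> i j; rewrite cint_lincomb//.
  have := congr1 (fun M : 'M[R[i]]_n => M i j) SHS; rewrite [RHS]mxE => <-.
  rewrite mxE exchange_big/=; apply: eq_bigr => l _.
  rewrite mxE mulr_suml; apply: eq_bigr => k _.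
  by rewrite !mxE mulrAC.
- move=> f /span[c fc].
  have lincombE (e : 'I_n -> R[i]) (g : 'I_n -> R[i]) :
      \sum_i e i * g i = ((\row_i e i) *m (\col_i g i)) 0 0.
    by rewrite mxE; apply: eq_bigr => i _; rewrite !mxE.
  (* The new family is S applied to the old one, so a row of coordinates is multiplied by S^-1 on
     the right. *)
  exists (fun i => ((\row_k c k) *m invmx S) 0 i).
  apply: filterS fc => x h xT; rewrite h// /lincomb !lincombE.
  rewrite [X in _ = (X *m _) _ _](_ : _ = \row_k c k *m invmx S); last first.
    by apply/rowP => i; rewrite mxE.
  rewrite [X in _ = (_ *m X) _ _](_ : _ = S *m \col_i b i x); last first.
    by apply/colP => i; rewrite !mxE; apply: eq_bigr => k _; rewrite mxE.
  by rewrite mulmxA mulmxKV.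
Qed.

Section Projection.
Variables (a : 'I_n -> T -> R[i]) (u : T -> R[i]).
Hypotheses (La : forall i, L2fun mu (a i)) (oa : L2orthonormal a) (Lu : L2fun mu u).

Definition proj_coef (i : 'I_n) : R[i] := cint mu (fun x => u x * Num.conj (a i x)).

Definition residual x := u x - lincomb proj_coef a x.

Lemma L2fun_residual : L2fun mu residual.
Proof.
rewrite /residual; under eq_fun do rewrite -mulN1r.
by apply: L2funD => //; apply: L2funZ; exact: L2fun_sum.
Qed.

Lemma residual_orthogonal i : cint mu (fun x => residual x * Num.conj (a i x)) = 0.
Proof.
have E x : residual x * Num.conj (a i x) =
    u x * Num.conj (a i x) +
    (-1) * (lincomb proj_coef a x * Num.conj (lincomb (fun j => (j == i)%:R) a x)).
  have -> : lincomb (fun j => (j == i)%:R) a x = a i x.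
    rewrite /lincomb (bigD1 i)//= eqxx mul1r big1 ?addr0// => j ji.
    by rewrite (negbTE ji) mul0r.
  by rewrite mulN1r /residual mulrBl.
under eq_fun do rewrite E.
have I2 : cintegrable mu (fun x => lincomb proj_coef a x *
    Num.conj (lincomb (fun j => (j == i)%:R) a x)).
  by apply: cintegrable_mulJ; exact: L2fun_sum.
rewrite cintD ?cintZ//; [|exact: cintegrable_mulJ|exact: cintegrableZ].
suff -> : cint mu (fun x => lincomb proj_coef a x *
    Num.conj (lincomb (fun j => (j == i)%:R) a x)) = proj_coef i.
  by rewrite mulN1r subrr.
rewrite cint_lincomb// (bigD1 i)//= [X in _ + X = _]big1 ?addr0.
  rewrite (bigD1 i)//= [X in _ + X = _]big1 ?addr0.
    by rewrite oa !eqxx conjC1 !mulr1.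
  by move=> j ji; rewrite (negbTE ji) conjC0 mulr0 mul0r.
move=> j ji; rewrite big1// => k _; rewrite oa.
have [<-|jk] := eqVneq j k; last by rewrite mulr0.
by rewrite (negbTE ji) conjC0 mulr0 mul0r.
Qed.

(** The difference of the projection and [lincomb e a] lies in the span, orthogonal to the residual,
    and its squared norm is the sum of squared coordinates. It serves both for the competitors in
    the best error and for the least squares approximation. *)
Lemma pythagoras e :
  (\int[mu]_x (sqmod (u x - lincomb e a x))%:E =
   \int[mu]_x (sqmod (residual x))%:E +
     (\sum_(i < n) sqmod (proj_coef i - e i))%:E)%E.
Proof.
pose h := lincomb (fun i => proj_coef i - e i) a.
have Lh : L2fun mu h by exact: L2fun_sum.
have Lg := L2fun_residual.
have uE x : u x - lincomb e a x = residual x + h x.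
  by rewrite /h -lincombB /residual addrA subrK.
under eq_fun do rewrite uE.
have Lgh := L2funD Lg Lh.
rewrite !integral_sqmod_fin// -EFinD; congr (_%:E).
have gh0 : cint mu (fun x => residual x * Num.conj (h x)) = 0.
  under eq_fun.
    move=> x; rewrite /h /lincomb rmorph_sum mulr_sumr.
    under eq_bigr do rewrite rmorphM/= mulrCA.
    over.
  rewrite cint_sum; last by move=> i; exact/cintegrableZ/cintegrable_mulJ.
  rewrite big1// => i _.
  by rewrite cintZ ?residual_orthogonal ?mulr0//; exact: cintegrable_mulJ.
have hg0 : cint mu (fun x => h x * Num.conj (residual x)) = 0.
  rewrite -[RHS]conjC0 -gh0 -cint_conj; last exact: cintegrable_mulJ.
  by congr cint; apply/funext => x; rewrite rmorphM/= conjCK mulrC.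
have hh : cint mu (fun x => h x * Num.conj (h x)) =
    (\sum_(i < n) sqmod (proj_coef i - e i))%:C.
  rewrite cint_lincomb// rmorph_sum; apply: eq_bigr => i _.
  rewrite (bigD1 i)//= big1 ?addr0 => [|j ji].
    by rewrite oa eqxx mulr1 mulJ_sqmod.
  by rewrite oa eq_sym (negbTE ji) mulr0.
have E x : (residual x + h x) * Num.conj (residual x + h x) =
    (residual x * Num.conj (residual x) + h x * Num.conj (h x)) +
    (residual x * Num.conj (h x) + h x * Num.conj (residual x)).
  by rewrite rmorphD/=; ring.
under eq_fun do rewrite E.
rewrite !cintD ?gh0 ?hg0 ?hh; try exact: cintegrable_mulJ.
- by rewrite !addr0 raddfD.
- by apply: cintegrableD; exact: cintegrable_mulJ.
- by apply: cintegrableD; exact: cintegrable_mulJ.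
Qed.

(** A competitor is a.e. a combination of the basis, and Pythagoras bounds its error below by the
    residual. *)
Lemma residual_le_best_error V : V `<=` L2fun mu ->
  (forall f, V f -> exists c, f = lincomb c a %[ae mu]) ->
  (\int[mu]_x (sqmod (residual x))%:E <= best_error mu V u ^+ 2)%E.
Proof.
move=> VL2 span; rewrite -normL2_sqr.
have N0 := normL2_ge0 mu residual.
suff le : (normL2 mu residual <= best_error mu V u)%E.
  by rewrite lee_sqr//; exact: le_trans le.
apply: le_ereal_inf_tmp => _ [v Vv <-].
have [c vc] := span _ Vv; have [mv _] := VL2 _ Vv; have [mu_ _] := Lu.
have mN f : cmeasurable f -> cmeasurable (fun x : T => - f x : R[i]).
  move=> mf; under eq_fun do rewrite -mulN1r.
  by apply: cmeasurableM => //; exact: cmeasurable_cst.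
rewrite -lee_sqr ?normL2_ge0// !normL2_sqr.
rewrite (@ae_eq_integral_sqmod (fun x => u x - v x) (fun x => u x - lincomb c a x)).
- rewrite pythagoras leeDl// lee_fin sumr_ge0// => i _; exact: sqmod_ge0.
- by apply: cmeasurableD => //; exact: mN.
- apply: cmeasurableD => //; apply: mN; apply: cmeasurable_sum => i.
  by apply: cmeasurableM; [exact: cmeasurable_cst|case: (La i)].
- by apply: filterS vc => x /= h xT; rewrite h.
Qed.

End Projection.
End Orthonormal.

(** * Sequential sampling *)

Section SampleExtension.
Context d (D : measurableType d) (R : realType) (k : nat).

Lemma measurable_thead : measurable_fun [set: k.+1.-tuple D] (@thead k D).
Proof. exact: measurable_tnth. Qed.

Lemma measurable_pair_cons :
  measurable_fun [set: k.-tuple D * D] (fun z => [tuple of z.2 :: z.1] : k.+1.-tuple D).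
Proof. exact: measurable_cons. Qed.

Lemma behead_cons (x : D) (X : k.-tuple D) : [tuple of behead [tuple of x :: X]] = X.
Proof. exact/val_inj. Qed.

(** [f (X, _)] is the conditional density of the new point given X, so by Tonelli [f] has total mass
    1 for the product of [sigma] and [rho]. The new law is the image under prepending the point. *)
Lemma extend_sample (sigma : probability (k.-tuple D) R) (rho : probability D R)
    (f : k.-tuple D * D -> R) :
  measurable_fun [set: k.-tuple D * D] f -> (forall z, 0 <= f z) ->
  {ae sigma, forall X, (\int[rho]_x (f (X, x))%:E = 1)%E} ->
  exists sigma' : probability (k.+1.-tuple D) R, forall F : k.+1.-tuple D -> \bar R,
    measurable_fun [set: k.+1.-tuple D] F -> (forall XX, (0 <= F XX)%E) ->
    (\int[sigma']_XX F XX =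
     \int[sigma]_X \int[rho]_x (F [tuple of x :: X] * (f (X, x))%:E))%E.
Proof.
move=> mf f0 f1.
have mfE : measurable_fun [set: k.-tuple D * D] (EFin \o f) by exact/measurable_EFinP.
have int1 : (\int[sigma \x rho]_z (f z)%:E = 1)%E.
  rewrite (fubini_tonelli1 _ mfE).
  rewrite (@ge0_ae_eq_integral _ _ _ _ _ _ (cst 1%E))//.
  - by rewrite integral_cst// mul1e; exact: probability_setT.
  - by apply: measurable_fun_fubini_tonelli_F => // z; rewrite lee_fin.
  - by move=> X _; apply: integral_ge0 => x _; rewrite lee_fin.
  - by apply: filterS f1 => X /= h _.
  - by move=> z; rewrite lee_fin.
have [P PE] := density_probability mf f0 int1.
pose cons_mfun : {mfun (k.-tuple D * D)%type >-> k.+1.-tuple D} :=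
  mfun_Sub (mem_set measurable_pair_cons).
exists (distribution P cons_mfun) => F mF F0.
have mFc : measurable_fun [set: k.-tuple D * D] (fun z => F [tuple of z.2 :: z.1]).
  exact: (measurableT_comp mF measurable_pair_cons).
rewrite ge0_integral_distribution// [LHS](PE (fun z => F [tuple of z.2 :: z.1]))//.
rewrite fubini_tonelli1//; first exact: emeasurable_funM.
by move=> z; rewrite mule_ge0 ?lee_fin.
Qed.

(* The density [M] only serves to replace [mu], which need not be sigma-finite, by a probability. *)
Lemma sample_step (mu : {measure set D -> \bar R}) (M : D -> R)
    (sigma : probability (k.-tuple D) R) (L : k.-tuple D * D -> R) :
  measurable_fun [set: D] M -> (forall x, 0 <= M x) -> (\int[mu]_x (M x)%:E = 1)%E ->
  measurable_fun [set: k.-tuple D * D] L -> (forall z, 0 <= L z) ->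
  (forall z, M z.2 = 0 -> L z = 0) ->
  {ae sigma, forall X, (2^-1%:E <= \int[mu]_x (L (X, x))%:E < +oo)%E} ->
  exists sigma' : probability (k.+1.-tuple D) R,
  [/\ {ae sigma', forall XX : k.+1.-tuple D, 0 < L ([tuple of behead XX], thead XX)},
      forall F : k.-tuple D -> \bar R, measurable_fun [set: k.-tuple D] F ->
        (forall X, (0 <= F X)%E) ->
        (\int[sigma']_XX F [tuple of behead XX] = \int[sigma]_X F X)%E
    & forall h : D -> \bar R, measurable_fun [set: D] h -> (forall x, (0 <= h x)%E) ->
        (\int[sigma']_XX ((L ([tuple of behead XX], thead XX))^-1%:E * h (thead XX))
          <= 2%:E * \int[mu]_x h x)%E].
Proof.
move=> mM M0 M1 mL L0 LM0 intL.
have [rho rhoE] := density_probability mM M0 M1.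
(* Density of [L] times [mu] relative to [rho]; where [M] vanishes so does [L], and the division is
   harmless. *)
pose q z := L z / M z.2.
have q0 z : 0 <= q z by rewrite divr_ge0.
have mq : measurable_fun [set: k.-tuple D * D] q.
  by apply: measurable_funM => //; apply: measurable_inv_fun; exact: measurableT_comp.
have qM z : q z * M z.2 = L z.
  have [M0'|M0'] := eqVneq (M z.2) 0; first by rewrite M0' mulr0 LM0.
  by rewrite /q divfK.
have mqX X : measurable_fun [set: D] (fun x => q (X, x)).
  exact: (measurableT_comp mq (measurable_pair1 X)).
have mLX X : measurable_fun [set: D] (fun x => L (X, x)).
  exact: (measurableT_comp mL (measurable_pair1 X)).
have intq X : (\int[rho]_x (q (X, x))%:E = \int[mu]_x (L (X, x))%:E)%E.
  rewrite rhoE; [|exact/measurable_EFinP|by move=> x; rewrite lee_fin].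
  by apply: eq_integral => x _; rewrite -EFinM qM.
(* Normalising constant of the conditional density. An infinite integral would be sent to 0 by
   [fine]; by [intL] the integral is finite and at least 1/2 for almost every X. *)
pose t X := fine (\int[rho]_x (q (X, x))%:E)%E.
have t0 X : 0 <= t X by apply/fine_ge0/integral_ge0 => x _; rewrite lee_fin.
have mt : measurable_fun [set: k.-tuple D] t.
  apply: measurableT_comp => //.
  apply: (@measurable_fun_fubini_tonelli_F _ _ _ _ _ rho (EFin \o q)).
    exact/measurable_EFinP.
  by move=> z; rewrite lee_fin.
pose f z := q z / t z.1.
have f0 z : 0 <= f z by rewrite divr_ge0.
have mf : measurable_fun [set: k.-tuple D * D] f.
  by apply: measurable_funM => //; apply: measurable_inv_fun; exact: measurableT_comp.
have mfX X : measurable_fun [set: D] (fun x => f (X, x)).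
  exact: (measurableT_comp mf (measurable_pair1 X)).
have tE X : (2^-1%:E <= \int[mu]_x (L (X, x))%:E < +oo)%E ->
    (t X)%:E = (\int[rho]_x (q (X, x))%:E)%E /\ 2^-1 <= t X.
  move=> /andP[h1 h2].
  have tE : (t X)%:E = (\int[rho]_x (q (X, x))%:E)%E.
    rewrite fineK// ge0_fin_numE ?intq//.
    by apply: integral_ge0 => x _; rewrite lee_fin.
  by split=> //; rewrite -lee_fin tE intq.
have f1 : {ae sigma, forall X, (\int[rho]_x (f (X, x))%:E = 1)%E}.
  apply: filterS intL => X /tE[tX t2].
  rewrite (eq_integral (fun x => (q (X, x))%:E * (t X)^-1%:E)%E) => [|x _]; last first.
    by rewrite -EFinM.
  rewrite ge0_integralZr//; last 3 first.
  - exact/measurable_EFinP.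
  - by move=> x _; rewrite lee_fin.
  - by rewrite lee_fin invr_ge0.
  by rewrite -tX -EFinM mulfV// gt_eqF//; apply: lt_le_trans t2; rewrite invr_gt0.
have [sigma' sigmaE] := extend_sample mf f0 f1.
have mbt : measurable_fun [set: k.+1.-tuple D]
    (fun XX : k.+1.-tuple D => ([tuple of behead XX] : k.-tuple D, thead XX)).
  by apply/measurable_fun_pairP; split; [exact: measurable_behead|exact: measurable_thead].
have mLbt : measurable_fun [set: k.+1.-tuple D]
    (fun XX : k.+1.-tuple D => L ([tuple of behead XX] : k.-tuple D, thead XX)).
  exact: (measurableT_comp mL mbt).
exists sigma'; split.
(* The density [f] contains the factor [L], so the zero set of [L] is not charged. *)
- pose B := [set XX : k.+1.-tuple D | L ([tuple of behead XX] : k.-tuple D, thead XX) = 0].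
  have mB : measurable B.
    by have := mLbt measurableT _ (measurable_set1 0); rewrite setTI.
  exists B; split=> //; last first.
    move=> XX /= /negP; rewrite -leNgt => h; apply/eqP; rewrite eq_le h.
    exact: L0.
  have <- : (\int[sigma']_XX (\1_B XX)%:E = sigma' B)%E by rewrite integral_indic// setIT.
  rewrite sigmaE; [|exact/measurable_EFinP/measurable_indic|by move=> XX; rewrite lee_fin].
  rewrite integral0_eq// => X _; rewrite integral0_eq// => x _.
  rewrite indicE; case: (boolP ([tuple of x :: X] \in B)) => [|_]; last by rewrite mul0e.
  rewrite inE /B /= theadE behead_cons => LXx.
  by rewrite /f /q LXx !mul0r mule0.
- move=> F mF F0; rewrite (sigmaE (fun XX => F [tuple of behead XX])) //; last first.
    exact: (measurableT_comp mF (@measurable_behead _ _ _)).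
  have E (X : k.-tuple D) : (\int[rho]_x (F [tuple of behead [tuple of x :: X]] * (f (X, x))%:E) =
              F X * \int[rho]_x (f (X, x))%:E)%E.
    under eq_integral do rewrite behead_cons.
    rewrite ge0_integralZl//; first exact/measurable_EFinP.
    by move=> x _; rewrite lee_fin.
  under eq_integral do rewrite E.
  have mint : measurable_fun [set: k.-tuple D] (fun X => \int[rho]_x (f (X, x))%:E)%E.
    apply: (@measurable_fun_fubini_tonelli_F _ _ _ _ _ rho (EFin \o f)).
      exact/measurable_EFinP.
    by move=> z; rewrite lee_fin.
  have int0 X : (0 <= \int[rho]_x (f (X, x))%:E)%E.
    by apply: integral_ge0 => x _; rewrite lee_fin.
  apply: ge0_ae_eq_integral => //.
  + exact: emeasurable_funM.
  + by move=> X _; rewrite mule_ge0.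
  + by apply: filterS f1 => X /= -> _; rewrite mule1.
- move=> h mh h0.
  pose G := fun z : k.-tuple D * D => ((L z)^-1%:E * h z.2 * (f z)%:E)%E.
  have mG : measurable_fun [set: k.-tuple D * D] G.
    apply: emeasurable_funM; last exact/measurable_EFinP.
    apply: emeasurable_funM; first exact/measurable_EFinP/measurable_inv_fun.
    exact: (measurableT_comp mh measurable_snd).
  have G0 z : (0 <= G z)%E by rewrite !mule_ge0// lee_fin// invr_ge0.
  have ih0 : (0 <= \int[mu]_x h x)%E by exact: integral_ge0.
  rewrite (sigmaE (fun XX => ((L ([tuple of behead XX], thead XX))^-1%:E * h (thead XX))%E)).
  + rewrite [leLHS](_ : _ = \int[sigma]_X \int[rho]_x G (X, x))%E; last first.
      apply: eq_integral => X _; apply: eq_integral => x _.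
      by rewrite behead_cons theadE.
    apply: (@le_trans _ _ (\int[sigma]_X (cst (2%:E * \int[mu]_x h x) X))%E); last first.
      rewrite integral_cst// [X in (_ * X <= _)%E](_ : _ = 1%E) ?mule1//.
      exact: probability_setT.
    apply: ae_ge0_le_integral => //.
    * by move=> X _; exact: integral_ge0.
    * exact: (@measurable_fun_fubini_tonelli_F _ _ _ _ _ rho G).
    * by move=> X _; rewrite mule_ge0// lee_fin.
    apply: filterS intL => X /tE[_ t2] _.
    have tpos : 0 < t X by apply: lt_le_trans t2; rewrite invr_gt0.
    have mGX : measurable_fun [set: D] (fun x => G (X, x)).
      exact: (measurableT_comp mG (measurable_pair1 X)).
    rewrite rhoE// -ge0_integralZl//.
    apply: ge0_le_integral => //.
    * by move=> x _; rewrite mule_ge0// lee_fin.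
    * by apply: emeasurable_funM => //; exact/measurable_EFinP.
    * exact: measurable_funeM.
    (* Relative to [mu], weight times density is L^-1 L / t: at most 1 / t <= 2, and 0 where [L]
       vanishes. *)
    move=> x _; rewrite /G /= -muleA -EFinM muleAC -EFinM lee_wpmul2r// lee_fin.
    rewrite /f /= mulrAC qM mulrA.
    have [->|L1] := eqVneq (L (X, x)) 0; first by rewrite mulr0 mul0r.
    by rewrite mulVf// mul1r -[leRHS]invrK lef_pV2 ?posrE ?invr_gt0.
  + apply: emeasurable_funM; first exact/measurable_EFinP/measurable_inv_fun.
    exact: (measurableT_comp mh measurable_thead).
  + by move=> XX; rewrite mule_ge0// lee_fin invr_ge0.
Qed.

End SampleExtension.

(** The tail of the longer sample has law [sigma]; test this on the indicator of the exceptional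
    null set. *)
Lemma ae_behead d (D : measurableType d) (R : realType) k
    (sigma : probability (k.-tuple D) R) (sigma' : probability (k.+1.-tuple D) R)
    (A : k.-tuple D -> Prop) :
  (forall F : k.-tuple D -> \bar R, measurable_fun [set: k.-tuple D] F ->
     (forall X, (0 <= F X)%E) ->
     (\int[sigma']_XX F [tuple of behead XX] = \int[sigma]_X F X)%E) ->
  {ae sigma, forall X, A X} ->
  {ae sigma', forall XX : k.+1.-tuple D, A [tuple of behead XX]}.
Proof.
move=> sE [B [mB B0 AB]].
pose B' := [set XX : k.+1.-tuple D | B [tuple of behead XX]].
have mB' : measurable B'.
  by have := @measurable_behead _ D k measurableT _ mB; rewrite setTI.
exists B'; split=> //; last by move=> XX /= h; exact: AB.
have sB : (\int[sigma']_XX (\1_B' XX)%:E = sigma' B')%E by rewrite integral_indic// setIT.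
have sA : (\int[sigma]_X (\1_B X)%:E = 0)%E by rewrite integral_indic// setIT.
by rewrite -sA -sE -?sB//; exact/measurable_EFinP/measurable_indic.
Qed.

(* Equal to [invmx] on invertible matrices, and visibly measurable in the entries. *)
Definition adjinv (K : fieldType) n (A : 'M[K]_n) : 'M[K]_n := (\det A)^-1 *: \adj A.

Lemma adjinvE (K : fieldType) n (A : 'M[K]_n) : A \in unitmx -> adjinv A = invmx A.
Proof. by rewrite /invmx => ->. Qed.

(** * The greedy random sample *)

Section Sampling.
Local Open Scope sesquilinear_scope.
Context d (D : measurableType d) (R : realType).
Variables (mu : {measure set D -> \bar R}) (n : nat) (a : 'I_n -> D -> R[i]).
Hypotheses (n_gt0 : (0 < n)%N) (La : forall i, L2fun mu (a i)) (oa : L2orthonormal mu a).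

(* Conjugated, so that [(evalv x)^* c] is the value at [x] of the function with coordinates [c]. *)
Definition evalv (x : D) : 'cV[R[i]]_n := \col_i Num.conj (a i x).

Lemma lincomb_evalv (c : 'cV[R[i]]_n) x :
  ((evalv x) ^t* *m c) 0 0 = lincomb (fun i => c i 0) a x.
Proof. by rewrite mxE; apply: eq_bigr => i _; rewrite !mxE conjCK mulrC. Qed.

Lemma mx_measurable_evalv : mx_measurable evalv.
Proof.
by move=> i j; under eq_fun do rewrite mxE; apply: cmeasurable_conj; case: (La i).
Qed.

Lemma qform_evalv (K : 'M[R[i]]_n) x :
  qform K (evalv x) = \sum_(i < n) \sum_(j < n) K i j * (a i x * Num.conj (a j x)).
Proof.
rewrite /qform mxE exchange_big/=; apply: eq_bigr => j _.
rewrite mxE mulr_suml; apply: eq_bigr => i _.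
by rewrite !mxE conjCK mulrA (mulrC (K i j)).
Qed.

Lemma cintegrable_qform (K : 'M[R[i]]_n) : cintegrable mu (fun x => qform K (evalv x)).
Proof.
under eq_fun do rewrite qform_evalv.
by do 2 apply: cintegrable_sum => ?; exact/cintegrableZ/cintegrable_mulJ.
Qed.

(** Orthonormality says that the rank-one matrices of [evalv x] integrate to the identity. This
    turns the trace bound on the barrier matrix into a bound on an integral over D. *)
Lemma cint_qform (K : 'M[R[i]]_n) : cint mu (fun x => qform K (evalv x)) = \tr K.
Proof.
under eq_fun do rewrite qform_evalv.
rewrite cint_sum; last first.
  by move=> i; apply: cintegrable_sum => j; exact/cintegrableZ/cintegrable_mulJ.
apply: eq_bigr => i _; rewrite cint_sum; last first.
  by move=> j; exact/cintegrableZ/cintegrable_mulJ.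
rewrite (bigD1 i)//= big1 ?addr0 => [|j ji]; rewrite cintZ ?oa; try exact: cintegrable_mulJ.
  by rewrite eqxx mulr1.
by rewrite eq_sym (negbTE ji) mulr0.
Qed.

(** Inverse of the Christoffel function of the space, divided by n to have integral 1. Its zeros are
    those of [evalv], hence every quadratic form in [evalv] vanishes there. *)
Definition christoffel (x : D) : R := (\sum_(i < n) sqmod (a i x)) / n%:R.

Lemma christoffel_ge0 x : 0 <= christoffel x.
Proof. by rewrite divr_ge0// sumr_ge0// => i _; exact: sqmod_ge0. Qed.

Lemma measurable_christoffel : measurable_fun [set: D] christoffel.
Proof.
apply: measurable_funM; last exact: measurable_cst.
by apply: measurable_sum => i; apply: measurable_sqmod; case: (La i).
Qed.

Lemma integral_christoffel : (\int[mu]_x (christoffel x)%:E = 1)%E.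
Proof.
have msq i : measurable_fun [set: D] (fun x => (sqmod (a i x))%:E).
  by apply/measurable_EFinP; apply: measurable_sqmod; case: (La i).
have sq0 i x : [set: D] x -> (0 <= (sqmod (a i x))%:E)%E by rewrite lee_fin sqmod_ge0.
rewrite /christoffel; under eq_integral do rewrite EFinM -sumEFin.
rewrite ge0_integralZr//; last 2 first.
- exact: emeasurable_sum.
- by move=> x _; apply: sume_ge0 => i _; exact: sq0.
rewrite ge0_integral_sum//.
under eq_bigr do rewrite integral_sqmod_fin// oa eqxx.
rewrite sumEFin sumr_const card_ord -EFinM divff//.
by rewrite pnatr_eq0 -lt0n.
Qed.

Lemma christoffel_eq0 x : christoffel x = 0 -> evalv x = 0.
Proof.
move=> /eqP; rewrite mulf_eq0 invr_eq0 pnatr_eq0 -[n == 0%N]negbK -lt0n n_gt0 orbF.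
rewrite psumr_eq0 => [/allP h|i _]; last exact: sqmod_ge0.
apply/matrixP => i j; rewrite !mxE.
have := h i (mem_index_enum _); rewrite sqmod_eq0 => /eqP ->.
by rewrite conjC0.
Qed.

Definition gram m (w : 'I_m -> R) (X : m.-tuple D) : 'M[R[i]]_n :=
  \sum_(j < m) (w j)%:C *: (evalv (tnth X j) *m (evalv (tnth X j)) ^t*).

Lemma mx_measurable_gram m (W : 'I_m -> m.-tuple D -> R) :
  (forall j, measurable_fun [set: m.-tuple D] (W j)) ->
  mx_measurable (fun X => gram (W^~ X) X).
Proof.
move=> mW; apply: mx_measurable_sum => j.
have mE : mx_measurable (fun X : m.-tuple D => evalv (tnth X j)).
  exact: (mx_measurable_comp mx_measurable_evalv (measurable_tnth j)).
apply: mx_measurableZ; first exact: cmeasurable_realC.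
by apply: mx_measurableM => //; exact: mx_measurable_adj.
Qed.
Definition well_conditioned (P : 'M[R[i]]_n) : Prop :=
  posdef P /\ \tr (invmx P) = 2^-1.

(** [barrier_mx] with inverses replaced by [adjinv]: measurable for every P, and equal to it for
    well-conditioned P. *)
Let barrier (P : 'M[R[i]]_n) : 'M[R[i]]_n :=
  let Z := adjinv (P - 1%:M) in (\tr Z - \tr (adjinv P))^-1 *: (Z *m Z) - Z.

(** Start of the induction: with no points drawn, the slack P is 2n I. *)
Lemma well_conditioned_scalar : well_conditioned (2 * n)%:R%:M.
Proof.
have n2_gt0 : 0 < (2 * n)%:R :> R[i] by rewrite ltr0n muln_gt0.
split; last first.
  rewrite invmx_scalar mxtrace_scalar -[LHS]mulr_natr natrM invfM -mulrA mulVf ?mulr1//.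
  by rewrite pnatr_eq0 -lt0n.
split; first by rewrite tr_scalar_mx map_scalar_mx/= rmorph_nat.
move=> v v0; rewrite qform_scalar mulr_gt0// lt_def sumr_ge0 ?andbT; last first.
  by move=> i _; rewrite exprn_ge0.
apply: contra_neq v0 => /psumr_eq0P v0; apply/matrixP => i j.
rewrite ord1 mxE; apply/eqP; rewrite -normr_eq0 -sqrf_eq0; apply/eqP.
by apply: v0 => // l _; exact: exprn_ge0.
Qed.

Let half_lt1 : 2^-1 < 1 :> R[i].
Proof. by rewrite invf_lt1 ?ltr1n. Qed.

Let barrierE P : well_conditioned P -> barrier P = barrier_mx P.
Proof.
move=> [pP tP]; rewrite /barrier /barrier_mx !adjinvE ?posdef_unit//.
by apply: posdef_sub1 => //; rewrite tP.
Qed.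

Lemma mx_measurable_barrier k (P : k.-tuple D -> 'M[R[i]]_n) :
  mx_measurable P -> mx_measurable (fun X => barrier (P X)).
Proof.
move=> mP; have mQ : mx_measurable (fun X => adjinv (P X - 1%:M)).
  by apply: mx_measurable_inv; apply: mx_measurableD => //; exact: mx_measurable_cst.
apply: mx_measurableD; last exact: mx_measurableN.
apply: mx_measurableZ; last exact: mx_measurableM.
apply: cmeasurable_inv; apply: cmeasurableD; first exact: cmeasurable_mxtrace.
under eq_fun do rewrite -mulN1r; apply: cmeasurableM; first exact: cmeasurable_cst.
by apply: cmeasurable_mxtrace; exact: mx_measurable_inv.
Qed.

Let level (P : 'M[R[i]]_n) x : R := Num.max 0 (complex.Re (qform (barrier P) (evalv x))).

Lemma measurable_level k (P : k.-tuple D -> 'M[R[i]]_n) : mx_measurable P ->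
  measurable_fun [set: k.-tuple D * D] (fun z => level (P z.1) z.2).
Proof.
move=> mP; apply: measurable_maxr; first exact: measurable_cst.
have mE : mx_measurable (fun z : k.-tuple D * D => evalv z.2).
  exact: (mx_measurable_comp mx_measurable_evalv measurable_snd).
have mB : mx_measurable (fun z : k.-tuple D * D => barrier (P z.1)).
  exact: (mx_measurable_comp (mx_measurable_barrier mP) measurable_fst).
have [] // : cmeasurable (fun z : k.-tuple D * D => qform (barrier (P z.1)) (evalv z.2)).
by do 2!apply: mx_measurableM => //; exact: mx_measurable_adj.
Qed.

(** The positive part dominates the form, whose integral is the trace of the barrier matrix, at
    least 1 - 1/2; it is also bounded by the modulus of the integrable form. *)
Lemma integral_level P : well_conditioned P ->
  (2^-1%:E <= \int[mu]_x (level P x)%:E < +oo)%E.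
Proof.
move=> gP; have [pP tP] := gP.
set K := barrier P; have [iK _] := cintegrable_qform K.
have mK := measurable_int mu iK.
have ilevel : mu.-integrable [set: D] (EFin \o level P).
  apply: le_integrable iK => //.
    apply/measurable_EFinP; apply: measurable_maxr; first exact: measurable_cst.
    exact/measurable_EFinP.
  move=> x _ /=; rewrite lee_fin /level -/K.
  by case: (leP 0 (complex.Re (qform K (evalv x)))) => h; rewrite ?normr0.
apply/andP; split; last first.
  have /integrableP[_] := ilevel.
  by under eq_integral => x _ do rewrite /= ger0_norm ?le_max ?lexx//.
have trK : 2^-1 <= complex.Re (\tr K).
  have := barrier_trace n_gt0 pP; rewrite tP => /(_ half_lt1).
  rewrite /K barrierE// lecE => /andP[_].
  suff -> : complex.Re (1 - 2^-1 : R[i]) = 2^-1 by [].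
  have -> : (1 - 2^-1 : R[i]) = (2^-1 : R)%:C.
    by rewrite (fmorphV (real_complex R)) rmorph_nat; field.
  by [].
apply: (@le_trans _ _ (complex.Re (\tr K))%:E); first by rewrite lee_fin.
rewrite -cint_qform /cint /= /Rintegral fineK; last exact: integrable_fin_num.
apply: le_integral => // x _.
by rewrite lee_fin /level le_max lexx orbT.
Qed.

Lemma level_christoffel_eq0 P x : christoffel x = 0 -> level P x = 0.
Proof. by move=> /christoffel_eq0 h; rewrite /level h qform0 /= maxxx. Qed.

Lemma well_conditioned_step P x : well_conditioned P -> 0 < level P x ->
  well_conditioned (P - 1%:M + (level P x)^-1%:C *: (evalv x *m (evalv x) ^t*)).
Proof.
move=> gP; have [pP tP] := gP.
have tP1 : \tr (invmx P) < 1 by rewrite tP.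
rewrite /level barrierE//.
set q := qform (barrier_mx P) (evalv x).
(* A Hermitian matrix has a real form, so taking the real part in [level] loses nothing. *)
have qR : (complex.Re q)%:C = q.
  apply: RRe_real; apply/CrealP.
  have <- : ((evalv x) ^t* *m barrier_mx P *m evalv x) ^t* 0 0 = Num.conj q.
    by rewrite mxE mxE.
  by rewrite !adjmxM adjmxK barrier_herm// mulmxA.
rewrite lt_max ltxx/= => q0; rewrite max_r ?ltW//.
have Q0 : 0 < q by rewrite -qR (_ : 0 = 0%:C)// ltcR.
have -> : ((complex.Re q)^-1)%:C = q^-1 by rewrite (fmorphV (real_complex R))/= qR.
have [] := barrier_step n_gt0 pP tP1 Q0.
by rewrite tP.
Qed.

(** Induction on k. A new draw leaves the law of the earlier points and their weights unchanged, so
    only the newest term has to be averaged, and it adds at most 2 int h dmu whatever the past. *)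
Lemma greedy_sample k : exists (sigma : probability (k.-tuple D) R)
    (W : 'I_k -> k.-tuple D -> R),
  [/\ forall j, measurable_fun [set: k.-tuple D] (W j),
      forall j X, 0 <= W j X,
      {ae sigma, forall X,
        well_conditioned (gram (W^~ X) X - (k%:R - (2 * n)%:R)%:M)}
    & forall h : D -> \bar R, measurable_fun [set: D] h -> (forall x, (0 <= h x)%E) ->
      (\int[sigma]_X (\sum_(j < k) (W j X)%:E * h (tnth X j))
        <= (2 * k)%:R%:E * \int[mu]_x h x)%E].
Proof.
elim: k => [|k [sigma [W [mW W0 good intW]]]].
  exists (dirac [tuple]), (fun _ _ => 0); split => //.
  - apply: nearW => X; rewrite /gram big_ord0 !sub0r -raddfN/= opprK.
    exact: well_conditioned_scalar.
  - move=> h mh h0; rewrite muln0 mul0e [leLHS]integral0_eq// => X _.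
    by rewrite big_ord0.
pose P X := gram (W^~ X) X - (k%:R - (2 * n)%:R)%:M.
have mP : mx_measurable P.
  by apply: mx_measurableD; [exact: mx_measurable_gram|exact: mx_measurable_cst].
pose L (z : k.-tuple D * D) := level (P z.1) z.2.
have L0 z : 0 <= L z by rewrite /L /level le_max lexx.
have mL : measurable_fun [set: k.-tuple D * D] L by exact: measurable_level.
have LM z : christoffel z.2 = 0 -> L z = 0 by exact: level_christoffel_eq0.
have iL : {ae sigma, forall X, (2^-1%:E <= \int[mu]_x (L (X, x))%:E < +oo)%E}.
  by apply: filterS good => X; exact: integral_level.
have [sigma' [pos beh new]] := sample_step measurable_christoffel christoffel_ge0
  integral_christoffel mL L0 LM iL.
pose bt (XX : k.+1.-tuple D) : k.-tuple D := [tuple of behead XX].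
have mbt : measurable_fun [set: k.+1.-tuple D] bt by exact: measurable_behead.
(* The newest point is the head: index 0 carries the weight 1 / L, computed from the tail, and the
   older weights are those of the tail. *)
pose W' (i : 'I_k.+1) (XX : k.+1.-tuple D) : R :=
  if unlift ord0 i is Some j then W j (bt XX) else (L (bt XX, thead XX))^-1.
have W'0 XX : W' ord0 XX = (L (bt XX, thead XX))^-1 by rewrite /W' unlift_none.
have W'S j XX : W' (lift ord0 j) XX = W j (bt XX) by rewrite /W' liftK.
have tS (XX : k.+1.-tuple D) j : tnth XX (lift ord0 j) = tnth (bt XX) j.
  by rewrite [in LHS](tuple_eta XX) tnthS.
have mW' i : measurable_fun [set: k.+1.-tuple D] (W' i).
  rewrite /W'; case: (unlift ord0 i) => [j|]; first exact: (measurableT_comp (mW j) mbt).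
  apply: measurable_inv_fun; apply: (measurableT_comp mL).
  by apply/measurable_fun_pairP; split; [exact: mbt|exact: measurable_thead].
have W'_ge0 i XX : 0 <= W' i XX.
  by rewrite /W'; case: (unlift ord0 i) => [j|]; rewrite ?W0// invr_ge0.
exists sigma', W'; split=> //.
- have := ae_behead beh good.
  apply: filterS2 pos => XX Lpos gX.
  have -> : gram (W'^~ XX) XX - (k.+1%:R - (2 * n)%:R)%:M =
      P (bt XX) - 1%:M + (L (bt XX, thead XX))^-1%:C *:
        (evalv (thead XX) *m (evalv (thead XX)) ^t*).
    rewrite /gram big_ord_recl W'0 /P /gram.
    under eq_bigr do rewrite W'S tS.
    rewrite (_ : k.+1%:R - (2 * n)%:R = k%:R - (2 * n)%:R + 1 :> R[i]); last first.
      by rewrite -natr1 addrAC.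
    by rewrite (raddfD (@scalar_mx _ n))/= opprD [RHS]addrC !addrA.
  exact: well_conditioned_step.
- move=> h mh h0.
  have mWh (i : 'I_k.+1) : measurable_fun [set: k.+1.-tuple D]
      (fun XX => ((W' i XX)%:E * h (tnth XX i))%E).
    apply: emeasurable_funM; first exact/measurable_EFinP.
    exact: (measurableT_comp mh (measurable_tnth i)).
  have Wh0 (i : 'I_k.+1) (XX : k.+1.-tuple D) : (0 <= (W' i XX)%:E * h (tnth XX i))%E.
    by rewrite mule_ge0// lee_fin.
  pose F (X : k.-tuple D) := (\sum_(j < k) (W j X)%:E * h (tnth X j))%E.
  have mF : measurable_fun [set: k.-tuple D] F.
    apply: emeasurable_sum => j; apply: emeasurable_funM; first exact/measurable_EFinP.
    exact: (measurableT_comp mh (measurable_tnth j)).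
  have F0 X : (0 <= F X)%E.
    by apply: sume_ge0 => j _; rewrite mule_ge0// lee_fin.
  have ih0 : (0 <= \int[mu]_x h x)%E by exact: integral_ge0.
  rewrite (eq_integral (fun XX => (W' ord0 XX)%:E * h (tnth XX ord0) +
    \sum_(j < k) (W' (lift ord0 j) XX)%:E * h (tnth XX (lift ord0 j)))%E) => [|XX _]; last first.
    by rewrite big_ord_recl.
  rewrite ge0_integralD//; last 2 first.
  + by move=> XX _; apply: sume_ge0 => j _.
  + exact: emeasurable_sum.
  have -> : (2 * k.+1)%:R%:E = (2%:E + (2 * k)%:R%:E)%E :> \bar R.
    by rewrite mulnS natrD EFinD.
  rewrite ge0_muleDl ?lee_fin//; apply: leeD.
    have := new h mh h0; congr (_ <= _)%E.
    by apply: eq_integral => XX _; rewrite W'0.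
  rewrite (eq_integral (fun XX => F (bt XX))) => [|XX _].
    by rewrite beh//; exact: intW.
  by apply: eq_bigr => j _; rewrite W'S tS.
Qed.

(** * Reconstruction from the weighted samples *)

Section Reconstruction.
Variables (m : nat) (W : 'I_m -> m.-tuple D -> R).
Hypotheses (mW : forall j, measurable_fun [set: m.-tuple D] (W j))
           (W0 : forall j X, 0 <= W j X).

(** Solution of the normal equations of the weighted least squares problem whenever the Gram matrix
    is invertible; [adjinv] makes it total and measurable. *)
Definition wls_coef (X : m.-tuple D) (y : m.-tuple R[i]) : 'cV[R[i]]_n :=
  adjinv (gram (W^~ X) X) *m
    \sum_(j < m) ((W j X)%:C * tnth y j) *: evalv (tnth X j).

Lemma mx_measurable_wls_coef (u : D -> R[i]) : cmeasurable u ->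
  mx_measurable (fun X : m.-tuple D => wls_coef X (map_tuple u X)).
Proof.
move=> mu_; apply: mx_measurableM; first exact/mx_measurable_inv/mx_measurable_gram.
apply: mx_measurable_sum => j; apply: mx_measurableZ; last first.
  exact: (mx_measurable_comp mx_measurable_evalv (measurable_tnth j)).
under eq_fun do rewrite tnth_map.
apply: cmeasurableM; first exact: cmeasurable_realC.
exact: (cmeasurable_comp mu_ (measurable_tnth j)).
Qed.

(** Split the data into projection plus residual. The first part is recovered exactly, so the
    coefficient error is the least squares solution for the residual, to which stability applies. *)
Lemma wls_coef_error (u : D -> R[i]) (X : m.-tuple D) (l : R) : 0 <= l ->
  posdef (gram (W^~ X) X - l%:C%:M) ->
  l * \sum_(i < n) sqmod (proj_coef mu a u i - wls_coef X (map_tuple u X) i 0) <=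
  \sum_(j < m) W j X * sqmod (residual mu a u (tnth X j)).
Proof.
move=> l0 pdG.
pose c : 'cV[R[i]]_n := \col_i proj_coef mu a u i.
pose A j := evalv (tnth X j); pose w j := (W j X)%:C.
pose r j := residual mu a u (tnth X j).
have w_ge0 j : 0 <= w j by rewrite /w (_ : 0 = 0%:C)// lecR.
have l_ge0 : 0 <= l%:C by rewrite (_ : 0 = 0%:C)// lecR.
have pdG' : posdef (\sum_(j < m) w j *: (A j *m (A j) ^t*) - l%:C%:M) by exact: pdG.
have coefE : wls_coef X (map_tuple u X) =
    c + invmx (gram (W^~ X) X) *m \sum_(j < m) (w j * r j) *: A j.
  rewrite /wls_coef adjinvE; last exact: (gram_unit l_ge0 pdG').
  rewrite -[c in RHS](least_squares_exact l_ge0 pdG') -mulmxDr -big_split/=.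
  congr (_ *m _); apply: eq_bigr => j _; rewrite -scalerDl -mulrDr tnth_map.
  congr ((_ * _) *: _); rewrite lincomb_evalv /r /residual.
  have -> : lincomb (c^~ 0) a (tnth X j) = lincomb (proj_coef mu a u) a (tnth X j).
    by apply: eq_bigr => i _; rewrite mxE.
  by rewrite addrC subrK.
have := least_squares_stable w_ge0 l_ge0 pdG' r.
rewrite -lecR rmorphM !rmorph_sum/=.
under eq_bigr do rewrite -sqmodE.
under [X in _ <= X]eq_bigr do rewrite -sqmodE.
move=> h; congr (_ <= _) : h.
  congr (_ * _); apply: eq_bigr => i _.
  by rewrite coefE [(c + _) i 0]mxE [c i 0]mxE opprD addrA subrr sub0r sqmodN.
by apply: eq_bigr => j _; rewrite rmorphM.
Qed.

End Reconstruction.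

End Sampling.

(** * Independence of the representative, measurability and the expected error *)

Theorem theorem1 (R : realType) :
  exists C K : R, [/\ 1 <= C, 1 <= K &
    forall (d : measure_display) (D : measurableType d)
      (mu : {measure set D -> \bar R}) (n : nat) (V : set (D -> R[i])),
    (1 <= n)%N -> L2subspace mu V -> L2dim mu V n ->
    exists (m : nat) (sigma : probability (m.-tuple D) R)
      (rec : m.-tuple D -> m.-tuple R[i] -> D -> R[i]),
    [/\ m%:R <= C * n%:R,
        forall (X : m.-tuple D) (y : m.-tuple R[i]), V (rec X y)
      & forall u : D -> R[i], L2fun mu u ->
        let ut (w : D -> R[i]) (X : m.-tuple D) := rec X (map_tuple w X) in
        let err (X : m.-tuple D) := normL2 mu (fun x => u x - ut u X x) in
        [/\ forall u' : D -> R[i], L2fun mu u' -> u = u' %[ae mu] ->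
              {ae sigma, forall X, ut u X = ut u' X %[ae mu]},
            measurable_fun [set: m.-tuple D] err
          & (\int[sigma]_X (err X ^+ 2)
               <= K%:E * best_error mu V u ^+ 2)%E]]].
Proof.
exists 4, 5; split; [by rewrite ler1n|by rewrite ler1n|].
move=> d D mu n V n_gt0 sV dimV.
have [a [Va oa span]] := orthonormal_basis sV dimV.
have [VL2 _ _ _ _] := sV.
have La i : L2fun mu (a i) by exact: VL2.
have [sigma [W [mW W0 good intW]]] := greedy_sample n_gt0 La oa (4 * n).
exists (4 * n)%N, sigma, (fun X y => lincomb (fun i => wls_coef a W X y i 0) a).
split; first by rewrite natrM.
  by move=> X y; exact: (L2subspace_lincomb _ sV Va).
move=> u Lu ut err.
pose g := residual mu a u.
pose delta (X : (4 * n).-tuple D) : R :=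
  \sum_(i < n) sqmod (proj_coef mu a u i - wls_coef a W X (map_tuple u X) i 0).
have delta0 X : 0 <= delta X by apply: sumr_ge0 => i _; exact: sqmod_ge0.
have mdelta : measurable_fun [set: (4 * n).-tuple D] delta.
  apply: measurable_sum => i; apply: measurable_sqmod; apply: cmeasurableD.
    exact: cmeasurable_cst.
  under eq_fun do rewrite -mulN1r; apply: cmeasurableM; first exact: cmeasurable_cst.
  by apply: mx_measurable_wls_coef => //; case: Lu.
have sqE X : (\int[mu]_x (sqmod (u x - ut u X x))%:E =
    \int[mu]_x (sqmod (g x))%:E + (delta X)%:E)%E.
  exact: (pythagoras La oa Lu).
have [mg _] := L2fun_residual La Lu.
have msq (v : D -> R[i]) : cmeasurable v -> measurable_fun [set: D] (fun x => (sqmod (v x))%:E).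
  by move=> mv; apply/measurable_EFinP; exact: measurable_sqmod.
have g0 : (0 <= \int[mu]_x (sqmod (g x))%:E)%E.
  by apply: integral_ge0 => x _; rewrite lee_fin sqmod_ge0.
have mF (h : D -> \bar R) : measurable_fun [set: D] h ->
    measurable_fun [set: (4 * n).-tuple D]
      (fun X : (4 * n).-tuple D => \sum_(j < 4 * n) (W j X)%:E * h (tnth X j))%E.
  move=> mh; apply: emeasurable_sum => j.
  apply: emeasurable_funM; first exact/measurable_EFinP.
  exact: (measurableT_comp mh (measurable_tnth j)).
split.
- move=> u' Lu' uu'.
  have muu' : cmeasurable (fun x => u x - u' x).
    apply: cmeasurableD; first by case: Lu.
    under eq_fun do rewrite -mulN1r; apply: cmeasurableM; first exact: cmeasurable_cst.
    by case: Lu'.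
  (* Since |u - u'|^2 has integral 0, its weighted sum over the sample vanishes almost surely: at
     each point the weight is 0 or the two values agree. The coefficients involve the data only
     through weight times value. *)
  have h_eq0 : (\int[mu]_x (sqmod (u x - u' x))%:E = 0)%E.
    rewrite (@ae_eq_integral_sqmod _ _ _ _ _ (fun=> 0))//.
    - by under eq_integral do rewrite sqmod0; rewrite integral0.
    - by apply: filterS uu' => x /= h xT; rewrite h// subrr.
  pose F (X : (4 * n).-tuple D) :=
    (\sum_(j < 4 * n) (W j X)%:E * (sqmod (u (tnth X j) - u' (tnth X j)))%:E)%E.
  have mFF : measurable_fun [set: (4 * n).-tuple D] F.
    exact: (mF _ (msq _ muu')).
  have F0 X : (0 <= F X)%E.
    by apply: sume_ge0 => j _; rewrite mule_ge0// lee_fin// sqmod_ge0.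
  have : (\int[sigma]_X `|F X| = 0)%E.
    under eq_integral do rewrite gee0_abs//.
    apply/eqP; rewrite eq_le; apply/andP; split; last exact: integral_ge0.
    have := intW (fun x => (sqmod (u x - u' x))%:E) (msq _ muu').
    by rewrite h_eq0 mule0; apply => x; rewrite lee_fin sqmod_ge0.
  move/(ae_eq_integral_abs sigma measurableT mFF).
  apply: filterS => X /(_ I) FX.
  suff -> : ut u X = ut u' X by exact: ae_eq_refl.
  rewrite /ut; congr lincomb; apply/funext => i; congr (_ _ _).
  rewrite /wls_coef; congr (_ *m _); apply: eq_bigr => j _; congr (_ *: _).
  rewrite !tnth_map; apply/eqP; rewrite -subr_eq0 -mulrBr mulf_eq0.
  move: FX; rewrite /F /= sumEFin => -[] /psumr_eq0P FX.
  have /eqP := FX (fun j _ => mulr_ge0 (W0 j X) (sqmod_ge0 _)) j isT.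
  by rewrite mulf_eq0 sqmod_eq0 => /orP[/eqP ->|->]; rewrite ?eqxx ?orbT.
(* By Pythagoras the error depends on the sample only through the measurable [delta]. *)
- rewrite /err; under eq_fun do rewrite normL2E sqE.
  apply: (measurableT_comp (measurable_poweR _)).
  by apply: emeasurable_funD => //; exact/measurable_EFinP.
- apply: (@le_trans _ _ (5%:E * \int[mu]_x (sqmod (g x))%:E)%E); last first.
    by rewrite lee_wpmul2l// residual_le_best_error.
  rewrite (eq_integral (fun X => \int[mu]_x (sqmod (g x))%:E + (delta X)%:E)%E)
    => [|X _]; last first.
    by rewrite normL2_sqr sqE.
  rewrite ge0_integralD//; last 2 first.
  - by move=> X _; rewrite lee_fin.
  - exact/measurable_EFinP.
  rewrite integral_cst// [X in (_ * X + _)%E](_ : _ = 1%E); last exact: probability_setT.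
  (* The 1 pays for the residual, the 4 for the expectation of [delta]. *)
  rewrite mule1 (_ : 5%:E = 1%:E + 4%:E :> \bar R)%E; last by rewrite -EFinD; congr EFin; ring.
  rewrite ge0_muleDl// mul1e leeD2l//.
  have n2 : 0 < (2 * n)%:R :> R by rewrite ltr0n muln_gt0.
  have := intW (fun x => (sqmod (g x))%:E) (msq _ mg) (fun x => sqmod_ge0 _).
  set Sg := (\int[sigma]_X _)%E => Sg_le.
  have le1 : (\int[sigma]_X (delta X)%:E <= (2 * n)%:R^-1%:E * Sg)%E.
    rewrite /Sg -ge0_integralZl//; last 2 first.
    - exact: (mF _ (msq _ mg)).
    - by move=> X _; apply: sume_ge0 => j _; rewrite mule_ge0// lee_fin// sqmod_ge0.
    apply: ae_ge0_le_integral => //.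
    - by move=> X _; rewrite lee_fin.
    - exact/measurable_EFinP.
    - move=> X _; rewrite mule_ge0 ?lee_fin ?invr_ge0 ?(ltW n2)//.
      by apply: sume_ge0 => j _; rewrite mule_ge0// lee_fin// sqmod_ge0.
    - by apply: measurable_funeM; exact: (mF _ (msq _ mg)).
    apply: filterS good => X [pdG _] _.
    rewrite /= sumEFin -EFinM lee_fin -ler_pdivrMl ?invr_gt0// invrK.
    apply: wls_coef_error => //.
    (* After 4n steps the shift is 4n - 2n, so the Gram matrix dominates 2n I. *)
    move: pdG; rewrite (_ : (4 * n)%:R - (2 * n)%:R = (2 * n)%:R%:C :> R[i])//.
    by rewrite rmorph_nat -natrB ?leq_mul2r ?orbT// -mulnBl.
  apply: (le_trans le1).
  apply: (@le_trans _ _ ((2 * n)%:R^-1%:E * ((2 * (4 * n))%:R%:E * \int[mu]_x (sqmod (g x))%:E))%E).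
    by rewrite lee_wpmul2l// lee_fin invr_ge0 ltW.
  rewrite muleA -EFinM lee_wpmul2r// lee_fin.
  by rewrite mulnCA (natrM _ 4) mulrCA mulVf ?mulr1// gt_eqF.
Qed.
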